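(* Let $\mathbf A=(A,v^0)$ be a special affine bundle over a manifold $M$. There are canonical isomorphisms of special affine bundles over $M$ $$\mathbf A\simeq \mathrm{AS}(\mathbf A^\#)\simeq \mathrm{LS}(\mathbf A^\dagger),\qquad a_m\leftrightarrow\sigma_{a_m}\leftrightarrow\widehat\sigma_{a_m}.$$ On the level of sections they take the form $$\mathrm{Sec}(\mathbf A)\simeq \mathrm{AffSec}(\mathbf A^\#)\simeq \mathrm{LinSec}(\mathbf A^\dagger),\qquad a\leftrightarrow\sigma_a\leftrightarrow\widehat\sigma_a,$$ where $\mathbf F^\dagger_{\widehat\sigma_a}=\iota_{\mathbf A^\dagger}(a)$ and $\mathbf F^\#_{\sigma_a}=\iota_{\mathbf A^\#}(a)$. The corresponding identification of the model vector bundles is $$\mathsf V(\mathbf A)=\mathrm{Aff}_M(\mathbf A^\#/\langle 1_A\rangle;\mathbb R)=\mathrm{Hom}_M(\mathbf A^\dagger/\langle 1_A\rangle;\mathbb R)=(\mathbf A^\dagger/\langle 1_A\rangle)^*,$$ and on sections it reads $X\leftrightarrow-\iota_X^\#\leftrightarrow-\iota_X^\dagger$, where $\iota^\dagger_X$ (a linear function on $\mathbf A^\dagger/\langle 1_A\rangle$) and $\iota^\#_X$ (an affine function on $\mathbf A^\#/\langle 1_A\rangle$) are the projections of the functions $\iota_{\mathbf A^\dagger}(X)$ on $\mathbf A^\dagger$ and $\iota_{\mathbf A^\#}(X)$ on $\mathbf A^\#$.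
   Context: All bundles are smooth, of finite rank, over $M$; morphisms cover the identity of $M$. An affine bundle $A\to M$ is modelled on a vector bundle $\mathsf V(A)$. A special affine bundle is a pair $\mathbf A=(A,v^0)$ with $A$ an affine bundle and $v^0$ a nowhere-vanishing section of $\mathsf V(A)$; isomorphisms of special affine bundles are affine bundle isomorphisms whose linear part preserves the distinguished sections. $\mathbf A^\dagger=A^\dagger=\mathrm{Aff}_M(A;\mathbb R)$ is the vector bundle whose fibre at $m$ is the space of affine functions $\varphi_m:A_m\to\mathbb R$ (linear part denoted $(\varphi_m)_{\mathsf v}$), with distinguished section $1_A$ (the constant function $1$). $\mathbf A^\#\subset\mathbf A^\dagger$ is the affine subbundle $\{\varphi_m:(\varphi_m)_{\mathsf v}(v^0(m))=1\}$, made special by the section $1_A$ of its model bundle $\{\varphi_m:(\varphi_m)_{\mathsf v}(v^0(m))=0\}$. $\langle 1_A\rangle$ is the line subbundle spanned by $1_A$; it is identified with $M\times\mathbb R$ by $r1_A\leftrightarrow r$. $\mathrm{AS}(\mathbf A^\#)$ is the affine bundle over $M$ whose fibre at $m$ is the set of affine sections of the projection $\mathbf A^\#_m\to\mathbf A^\#_m/\langle 1_A\rangle_m$; it is modelled on $\mathrm{Aff}_M(\mathbf A^\#/\langle1_A\rangle;\langle 1_A\rangle)$ and is special with the distinguished section $[\varphi_m]\mapsto-1_A(m)$. $\mathrm{LS}(\mathbf A^\dagger)$ is the affine bundle whose fibre at $m$ is the set of linear sections of $\mathbf A^\dagger_m\to\mathbf A^\dagger_m/\langle 1_A\rangle_m$;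 it is modelled on $\mathrm{Hom}_M(\mathbf A^\dagger/\langle1_A\rangle;\langle 1_A\rangle)$ and is special with the distinguished section $[\varphi_m]\mapsto-(\varphi_m)_{\mathsf v}(v^0(m))\,1_A(m)$. $\mathrm{AffSec}(\mathbf A^\#)$ and $\mathrm{LinSec}(\mathbf A^\dagger)$ are the spaces of smooth sections of these bundles, i.e. affine (resp. linear) sections of $\mathbf A^\#\to\mathbf A^\#/\langle1_A\rangle$ (resp. $\mathbf A^\dagger\to\mathbf A^\dagger/\langle1_A\rangle$). For a section $\sigma$ of $\mathbf A^\#\to\mathbf A^\#/\langle1_A\rangle$ the function $\mathbf F^\#_\sigma$ on $\mathbf A^\#$ is defined by $\varphi=\sigma([\varphi])+\mathbf F^\#_\sigma(\varphi)1_A$; $\mathbf F^\dagger_{\widehat\sigma}$ on $\mathbf A^\dagger$ is defined in the same way for a section $\widehat\sigma$ of $\mathbf A^\dagger\to\mathbf A^\dagger/\langle1_A\rangle$. For a section $a$ of $A$, $\iota_{\mathbf A^\dagger}(a)(\varphi_m)=\varphi_m(a(m))$, and for a section $X$ of $\mathsf V(A)$, $\iota_{\mathbf A^\dagger}(X)(\varphi_m)=(\varphi_m)_{\mathsf v}(X(m))$; $\iota_{\mathbf A^\#}$ denotes the restriction of these functions to $\mathbf A^\#$. The functions $\iota_{\mathbf A^\dagger}(X)$, $\iota_{\mathbf A^\#}(X)$ are invariant under translations by $1_A$, hence project to the quotients. *)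

(* Defs.v *)
From HB Require Import structures.
From mathcomp Require Import all_boot all_order all_algebra.
From mathcomp Require Import generic_quotient ring_quotient.
From mathcomp Require Import all_classical all_reals all_analysis.

Set Implicit Arguments.
Unset Strict Implicit.
Unset Printing Implicit Defensive.

Import Order.TTheory GRing.Theory Num.Theory.
Import numFieldNormedType.Exports.

Local Open Scope classical_set_scope.
Local Open Scope quotient_scope.
Local Open Scope ring_scope.

(** A [preaffine] space is a set with an action of a vector space; it is an
    affine space when it satisfies [is_affine].  The two are separated because
    nonemptiness and simple transitivity of the constructions below are not
    formal: they use [v0 m <> 0] and finite dimensionality.  They are required
    of every fibre in [is_affine_bundle]. *)

Record preaffine (R : realType) := PreAffine {
  pt :> choiceType;
  dirv : lmodType R;
  act : pt -> dirv -> pt;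
  act0 : forall a, act a 0 = a;
  actD : forall a u v, act (act a u) v = act a (u + v) }.

Definition is_affine (R : realType) (A : preaffine R) : Prop :=
  (exists a : A, True) /\ forall a b : A, exists! u : dirv A, b = act a u.

Section Functionals.
Context {R : realType}.

(** An affine function is kept together with its linear part, which the
    function determines as soon as the affine space is nonempty. *)
Definition is_affun (A : preaffine R) : {pred (A -> R^o) * (dirv A -> R^o)} :=
  fun p => `[< linear p.2 /\
               forall a u, p.1 (act a u) = p.1 a + p.2 u >].

Lemma is_affun_submod (A : preaffine R) : submod_closed (@is_affun A).
Proof.
split.
  apply/asboolP; split=> [c u v|a u] /=; first by rewrite scaler0 addr0.
  by rewrite addr0.
move=> c p q /asboolP[lp hp] /asboolP[lq hq]; apply/asboolP; split=> [e u v|a u] /=.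
  rewrite [LHS](_ : _ = c *: p.2 (e *: u + v) + q.2 (e *: u + v)) //.
  by rewrite lp lq !scalerDr !scalerA [e * c]mulrC addrACA.
rewrite [LHS](_ : _ = c *: p.1 (act a u) + q.1 (act a u)) //.
by rewrite hp hq scalerDr addrACA.
Qed.

HB.instance Definition _ A :=
  GRing.isSubmodClosed.Build R _ (@is_affun A) (is_affun_submod A).

Record affun (A : preaffine R) := AffFun {
  affun_val : ((A -> R^o) * (dirv A -> R^o))%type;
  affunP : affun_val \in @is_affun A }.

HB.instance Definition _ A := [isSub for @affun_val A].
HB.instance Definition _ A := [Choice of affun A by <:].
HB.instance Definition _ A := [SubChoice_isSubLmodule of affun A by <:].

Definition affun_app A (f : affun A) (a : A) : R := (val f).1 a.
Definition linpart A (f : affun A) (u : dirv A) : R := (val f).2 u.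

Lemma affun1P (A : preaffine R) :
  ((fun=> 1, fun=> 0) : (A -> R^o) * (dirv A -> R^o)) \in @is_affun A.
Proof.
by apply/asboolP; split=> [c u v|a u] /=; rewrite ?scaler0 addr0.
Qed.

Definition affun1 A : affun A := AffFun (affun1P A).

Definition is_linform (V : lmodType R) : {pred V -> R^o} :=
  fun f => `[< linear f >].

Lemma is_linform_submod (V : lmodType R) : submod_closed (@is_linform V).
Proof.
split; first by apply/asboolP => c u v /=; rewrite scaler0 addr0.
move=> c f g /asboolP lf /asboolP lg; apply/asboolP => e u v /=.
rewrite [LHS](_ : _ = c *: f (e *: u + v) + g (e *: u + v)) //.
by rewrite lf lg !scalerDr !scalerA [e * c]mulrC addrACA.
Qed.

HB.instance Definition _ V :=
  GRing.isSubmodClosed.Build R _ (@is_linform V) (is_linform_submod V).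

Record linform (V : lmodType R) := LinForm {
  linform_val : V -> R^o;
  linformP : linform_val \in @is_linform V }.

HB.instance Definition _ V := [isSub for @linform_val V].
HB.instance Definition _ V := [Choice of linform V by <:].
HB.instance Definition _ V := [SubChoice_isSubLmodule of linform V by <:].

End Functionals.

Coercion affun_app : affun >-> Funclass.
Coercion linform_val : linform >-> Funclass.

Section Quotients.
Context {R : realType}.

Definition line (V : lmodType R) (v : V) : {pred V} :=
  fun u => `[< exists r : R, u = r *: v >].

Lemma line_submod (V : lmodType R) (v : V) : submod_closed (line v).
Proof.
split; first by apply/asboolP; exists 0; rewrite scale0r.
move=> c x y /asboolP[r ->] /asboolP[s ->]; apply/asboolP.
by exists (c * r + s); rewrite scalerDl scalerA.
Qed.

HB.instance Definition _ V v :=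
  GRing.isSubmodClosed.Build R V (line v) (@line_submod V v).

Definition vquo (V : lmodType R) (v : V) := {ideal_quot (line v)}.

HB.instance Definition _ V v := GRing.Zmodule.on (@vquo V v).

Definition vcls (V : lmodType R) (v : V) : V -> vquo v := \pi_(vquo v).

Lemma vclsP (V : lmodType R) (v x y : V) :
  vcls v x = vcls v y <-> exists r : R, x = y + r *: v.
Proof.
split=> [/eqP|[r ->]].
  rewrite -Quotient.idealrBE => /asboolP[r h].
  by exists r; rewrite -h addrC subrK.
apply/eqP; rewrite -Quotient.idealrBE; apply/asboolP.
by exists r; rewrite addrC addKr.
Qed.

Lemma vclsD (V : lmodType R) (v x y : V) :
  vcls v (x + y) = vcls v x + vcls v y.
Proof. by rewrite /vcls; rewrite !piE. Qed.

Lemma vcls_repr (V : lmodType R) (v : V) (q : vquo v) : vcls v (repr q) = q.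
Proof. exact: reprK. Qed.

Lemma vquo_ind (V : lmodType R) (v : V) (P : vquo v -> Prop) :
  (forall x, P (vcls v x)) -> forall q, P q.
Proof. by move=> h q; rewrite -(vcls_repr q). Qed.

Definition vquo_scale (V : lmodType R) (v : V) (c : R) (q : vquo v) : vquo v :=
  vcls v (c *: repr q).

Lemma vclsZ (V : lmodType R) (v : V) c x :
  vquo_scale c (vcls v x) = vcls v (c *: x).
Proof.
apply/vclsP; have /vclsP[r h] := vcls_repr (vcls v x).
by exists (c * r); rewrite h scalerDr scalerA.
Qed.

Fact vquo_scaleA (V : lmodType R) (v : V) a b (q : vquo v) :
  vquo_scale a (vquo_scale b q) = vquo_scale (a * b) q.
Proof. by elim/vquo_ind: q => x; rewrite !vclsZ scalerA. Qed.
Fact vquo_scale1 (V : lmodType R) (v : V) : left_id 1 (@vquo_scale V v).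
Proof. by elim/vquo_ind => x; rewrite vclsZ scale1r. Qed.
Fact vquo_scaleDr (V : lmodType R) (v : V) :
  right_distributive (@vquo_scale V v) +%R.
Proof.
move=> c; elim/vquo_ind => x; elim/vquo_ind => y.
by rewrite -vclsD !vclsZ scalerDr vclsD.
Qed.
Fact vquo_scaleDl (V : lmodType R) (v : V) (q : vquo v) :
  {morph (@vquo_scale V v)^~ q : a b / a + b}.
Proof.
by move=> a b; elim/vquo_ind: q => x; rewrite !vclsZ scalerDl vclsD.
Qed.

HB.instance Definition _ V v := GRing.Zmodule_isLmodule.Build R (@vquo V v)
  (@vquo_scaleA V v) (@vquo_scale1 V v) (@vquo_scaleDr V v) (@vquo_scaleDl V v).

Definition aequiv (A : preaffine R) (v : dirv A) : rel A :=
  fun a b => `[< exists r : R, a = act b (r *: v) >].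

Lemma aequiv_equiv (A : preaffine R) (v : dirv A) :
  equiv_class_of (aequiv v).
Proof.
have sym (a b : A) : aequiv v a b -> aequiv v b a.
  move=> /asboolP[r ->]; apply/asboolP; exists (- r).
  by rewrite actD -scalerDl subrr scale0r act0.
split=> [a|a b|b a c].
- by apply/asboolP; exists 0; rewrite scale0r act0.
- by apply/idP/idP; exact: sym.
- move=> /asboolP[r ->] /asboolP[s ->]; apply/asboolP; exists (s + r).
  by rewrite actD scalerDl.
Qed.

Canonical aequiv_eq (A : preaffine R) (v : dirv A) :=
  EquivRelPack (aequiv_equiv v).

Definition aquo_pt (A : preaffine R) (v : dirv A) : choiceType :=
  {eq_quot (aequiv v)}.

Definition acls (A : preaffine R) (v : dirv A) (a : A) : aquo_pt v :=
  \pi_({eq_quot (aequiv v)}) a.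

Lemma aclsP (A : preaffine R) (v : dirv A) (a b : A) :
  acls v a = acls v b <-> exists r : R, a = act b (r *: v).
Proof.
split=> [/eqquotP/asboolP //|h].
by apply/eqP; rewrite /acls piE; apply/asboolP.
Qed.

Definition arepr (A : preaffine R) (v : dirv A) (q : aquo_pt v) : A :=
  @repr A {eq_quot (aequiv v)} q.

Lemma acls_repr (A : preaffine R) (v : dirv A) (q : aquo_pt v) :
  acls v (arepr q) = q.
Proof. exact: (@reprK A {eq_quot (aequiv v)}). Qed.

Definition aquo_act (A : preaffine R) (v : dirv A)
    (q : aquo_pt v) (u : vquo v) : aquo_pt v :=
  acls v (act (arepr q) (repr u)).

Lemma acls_act (A : preaffine R) (v : dirv A) (a : A) (u : dirv A) :
  aquo_act (acls v a) (vcls v u) = acls v (act a u).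
Proof.
apply/aclsP; have /aclsP[r ->] := acls_repr (acls v a).
have /vclsP[s ->] := vcls_repr (vcls v u).
by exists (r + s); rewrite !actD scalerDl addrCA.
Qed.

Fact aquo_act0 (A : preaffine R) (v : dirv A) (q : aquo_pt v) :
  aquo_act q 0 = q.
Proof.
rewrite -[in LHS](acls_repr q) (_ : 0 = vcls v 0); last by rewrite /vcls piE.
by rewrite acls_act act0 acls_repr.
Qed.

Fact aquo_actD (A : preaffine R) (v : dirv A) (q : aquo_pt v) (u w : vquo v) :
  aquo_act (aquo_act q u) w = aquo_act q (u + w).
Proof.
rewrite -(acls_repr q); elim/vquo_ind: u => u; elim/vquo_ind: w => w.
by rewrite -vclsD !acls_act actD.
Qed.

Definition aquo (A : preaffine R) (v : dirv A) : preaffine R :=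
  PreAffine (@aquo_act0 A v) (@aquo_actD A v).

End Quotients.

Section Sharp.
Context {R : realType} (A : preaffine R) (v : dirv A).

Definition sharp_pt : choiceType := {f : affun A | linpart f v == 1}.

Definition is_sharp_dir : {pred affun A} := fun f => linpart f v == 0.

Lemma is_sharp_dir_submod : submod_closed is_sharp_dir.
Proof.
split; first by rewrite /in_mem /= /is_sharp_dir /linpart.
move=> c f g /eqP hf /eqP hg; apply/eqP.
rewrite [LHS](_ : _ = c *: (linpart f v : R^o) + linpart g v) //.
by rewrite hf hg scaler0 addr0.
Qed.

HB.instance Definition _ :=
  GRing.isSubmodClosed.Build R _ is_sharp_dir is_sharp_dir_submod.

Record sharp_dir := SharpDir {
  sharp_dir_val : affun A;
  sharp_dirP : sharp_dir_val \in is_sharp_dir }.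

HB.instance Definition _ := [isSub for sharp_dir_val].
HB.instance Definition _ := [Choice of sharp_dir by <:].
HB.instance Definition _ := [SubChoice_isSubLmodule of sharp_dir by <:].

Fact sharp_actP (f : sharp_pt) (g : sharp_dir) :
  linpart (val f + val g) v == 1.
Proof.
case: f g => f /= /eqP hf [g /= /eqP hg]; apply/eqP.
by rewrite [LHS](_ : _ = linpart f v + linpart g v) // hf hg addr0.
Qed.

Definition sharp_act (f : sharp_pt) (g : sharp_dir) : sharp_pt :=
  exist _ (val f + val g) (sharp_actP f g).

Fact sharp_act0 f : sharp_act f 0 = f.
Proof. by apply: val_inj; rewrite /= addr0. Qed.
Fact sharp_actD f g h : sharp_act (sharp_act f g) h = sharp_act f (g + h).
Proof. by apply: val_inj; rewrite /= addrA. Qed.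

Definition sharp : preaffine R := PreAffine sharp_act0 sharp_actD.

Fact sharp1P : affun1 A \in is_sharp_dir.
Proof. by rewrite /in_mem /= /is_sharp_dir /linpart. Qed.

Definition sharp1 : dirv sharp := SharpDir sharp1P.

End Sharp.

Section AffineSections.
Context {R : realType} (B : preaffine R) (w : dirv B).

(** The line spanned by [w] is identified with [R] by [r *: w <-> r], so the
    affine sections of [B -> B/<w>] are acted upon by real-valued affine
    functions on [B/<w>]. *)
Definition is_asec (s : aquo w -> B) : Prop :=
  (exists L : dirv (aquo w) -> dirv B,
     linear L /\ forall q u, s (act q u) = act (s q) (L u)) /\
  (forall q, acls w (s q) = q).

Definition asec_pt : choiceType := {s : aquo w -> B | `[< is_asec s >]}.

Fact asec_actP (s : asec_pt) (f : affun (aquo w)) :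
  `[< is_asec (fun q => act (val s q) (f q *: w)) >].
Proof.
case: s => s /= /asboolP[[L [lL hL]] hs].
have /asboolP[lf hf] := affunP f.
apply/asboolP; split; last first.
  by move=> q; rewrite -[RHS]hs; apply/aclsP; exists (f q).
exists (fun u => L u + linpart f u *: w); split=> [c x y|q u].
  rewrite lL /linpart lf !scalerDl scalerDr scalerA.
  by rewrite addrACA.
by rewrite hL /affun_app hf scalerDl !actD [L u + _]addrCA [LHS]/=.
Qed.

Definition asec_act (s : asec_pt) (f : affun (aquo w)) : asec_pt :=
  exist (fun s : aquo w -> B => `[< is_asec s >] : Prop) _ (asec_actP s f).

Fact asec_act0 s : asec_act s 0 = s.
Proof. by apply: val_inj; apply: funext => q /=; rewrite scale0r act0. Qed.
Fact asec_actD s f g : asec_act (asec_act s f) g = asec_act s (f + g).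
Proof.
by apply: val_inj; apply: funext => q /=; rewrite actD -scalerDl.
Qed.

Definition asec : preaffine R := PreAffine asec_act0 asec_actD.

End AffineSections.

Section LinearSections.
Context {R : realType} (V : lmodType R) (w : V).

Definition is_lsec (s : vquo w -> V) : Prop :=
  linear s /\ forall q, vcls w (s q) = q.

Definition lsec_pt : choiceType := {s : vquo w -> V | `[< is_lsec s >]}.

Fact lsec_actP (s : lsec_pt) (f : linform (vquo w)) :
  `[< is_lsec (fun q => val s q + f q *: w) >].
Proof.
case: s => s /= /asboolP[ls hs]; have /asboolP lf := linformP f.
apply/asboolP; split=> [c x y|q].
  by rewrite ls lf !scalerDl scalerDr scalerA addrACA.
by rewrite -[RHS]hs; apply/vclsP; exists (f q).
Qed.

Definition lsec_act (s : lsec_pt) (f : linform (vquo w)) : lsec_pt :=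
  exist (fun s : vquo w -> V => `[< is_lsec s >] : Prop) _ (lsec_actP s f).

Fact lsec_act0 s : lsec_act s 0 = s.
Proof. by apply: val_inj; apply: funext => q /=; rewrite scale0r addr0. Qed.
Fact lsec_actD s f g : lsec_act (lsec_act s f) g = lsec_act s (f + g).
Proof.
by apply: val_inj; apply: funext => q /=; rewrite -addrA -scalerDl.
Qed.

Definition lsec : preaffine R := PreAffine lsec_act0 lsec_actD.

End LinearSections.

(** The functions [F_s] of sections [s] of [B -> B/<w>]; [xget] is a definite
    description when [w <> 0] and [B] is an affine space. *)
Definition afun_of_sec (R : realType) (B : preaffine R) (w : dirv B)
    (s : aquo w -> B) (b : B) : R :=
  xget 0 [set r : R | b = act (s (acls w b)) (r *: w)].

Definition vfun_of_sec (R : realType) (V : lmodType R) (w : V)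
    (s : vquo w -> V) (x : V) : R :=
  xget 0 [set r : R | x = s (vcls w x) + r *: w].

Section Iota.
Context {R : realType} (A : preaffine R).

Fact iota_dag_proof (u : dirv A) :
  (fun q : vquo (affun1 A) => linpart (repr q) u : R^o)
    \in @is_linform R (vquo (affun1 A)).
Proof.
have E f : linpart (repr (vcls (affun1 A) f)) u = linpart f u.
  have /vclsP[r ->] := vcls_repr (vcls (affun1 A) f).
  by rewrite /linpart /= scaler0 addr0.
apply/asboolP => c x y; rewrite -(vcls_repr x) -(vcls_repr y).
move: (repr x) (repr y) => f g.
have -> : c *: vcls (affun1 A) f + vcls (affun1 A) g
          = vcls (affun1 A) (c *: f + g).
  by rewrite vclsD -vclsZ.
by rewrite !E.
Qed.

(** The projections to [A^dag / <1_A>] and [A^# / <1_A>] of the function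
    [phi |-> linpart phi u]. *)
Definition iota_dag (u : dirv A) : linform (vquo (affun1 A)) :=
  LinForm (iota_dag_proof u).

Lemma iota_dagE (u : dirv A) (f : affun A) :
  iota_dag u (vcls (affun1 A) f) = linpart f u.
Proof.
rewrite /=; have /vclsP[r ->] := vcls_repr (vcls (affun1 A) f).
by rewrite /linpart /= scaler0 addr0.
Qed.

Variable v : dirv A.

Fact iota_sharp_proof (u : dirv A) :
  ((fun q : aquo (sharp1 v) => linpart (val (arepr q)) u : R^o),
   (fun q : dirv (aquo (sharp1 v)) =>
      linpart (sharp_dir_val (@repr (sharp_dir v) (vquo (sharp1 v)) q)) u : R^o))
    \in @is_affun R (aquo (sharp1 v)).
Proof.
pose w := sharp1 v.
have Ea (f : sharp v) : linpart (val (arepr (acls w f))) u = linpart (val f) u.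
  have /aclsP[r ->] := acls_repr (acls w f).
  by rewrite /linpart /= scaler0 addr0.
have Ev (f : sharp_dir v) :
    linpart (sharp_dir_val (repr (vcls w f))) u = linpart (sharp_dir_val f) u.
  have /vclsP[r ->] := vcls_repr (vcls w f).
  by rewrite /linpart /= scaler0 addr0.
apply/asboolP; split => /=.
  move=> c x y; rewrite -(vcls_repr x) -(vcls_repr y).
  move: (repr x) (repr y) => f g.
  have -> : c *: vcls w f + vcls w g = vcls w (c *: f + g).
    by rewrite vclsD -vclsZ.
  by rewrite !Ev.
move=> q x; rewrite -(@acls_repr R (sharp v) w q) -(vcls_repr x).
rewrite (@acls_act R (sharp v) w).
by rewrite !(Ea, Ev).
Qed.

Definition iota_sharp (u : dirv A) : affun (aquo (sharp1 v)) :=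
  AffFun (iota_sharp_proof u).

Lemma iota_sharpE (u : dirv A) (f : sharp v) :
  iota_sharp u (acls (sharp1 v) f) = linpart (val f) u.
Proof.
rewrite /affun_app /=; have /aclsP[r ->] := acls_repr (acls (sharp1 v) f).
by rewrite /linpart /= scaler0 addr0.
Qed.

End Iota.

Section Smooth.
Context {R : realType}.

Fixpoint Ck (k : nat) (d : nat) (D : set 'rV[R]_d) (f : 'rV[R]_d -> R) : Prop :=
  (forall x, D x -> {for x, continuous f}) /\
  if k is k'.+1 then
    forall i : 'I_d, (forall x, D x -> derivable f x (delta_mx 0 i)) /\
                     Ck k' D (fun x => 'D_(delta_mx 0 i) f x)
  else True.

Definition Cinfty (d : nat) (D : set 'rV[R]_d) (f : 'rV[R]_d -> R) : Prop :=
  forall k, Ck k D f.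

Record chart (d : nat) (M : topologicalType) := Chart {
  cdom : set M;
  cmap : M -> 'rV[R]_d;
  cinv : 'rV[R]_d -> M }.

Definition is_chart d (M : topologicalType) (c : chart d M) : Prop :=
  [/\ open (cdom c), open (cmap c @` cdom c),
      (forall m, cdom c m -> cinv c (cmap c m) = m),
      {within cdom c, continuous (cmap c)} &
      {within cmap c @` cdom c, continuous (cinv c)}].

Definition compatible d (M : topologicalType) (c c' : chart d M) : Prop :=
  forall j, Cinfty (cmap c @` (cdom c `&` cdom c'))
                   (fun x => cmap c' (cinv c x) ord0 j).

Record manifold (d : nat) := Manifold {
  mpt :> topologicalType;
  matlas : set (chart d mpt);
  mhausdorff : hausdorff_space mpt;
  mcountable : @second_countable mpt;
  mchart : forall c, matlas c -> is_chart c;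
  mcover : forall m, exists2 c, matlas c & cdom c m;
  mcompat : forall c c', matlas c -> matlas c' -> compatible c c' }.

End Smooth.

Arguments manifold : clear implicits.

(** A bundle is a family of fibres with an atlas of local trivializations.
    The records [vecdata], [affdata] and [special_affdata] carry no axioms;
    these are in [is_vector_bundle], [is_affine_bundle] and
    [is_special_affine_bundle].  The rank is finite and locally constant. *)

Section Bundles.
Context {R : realType} {d : nat} {M : manifold R d}.

Definition smooth_on (W : set M) (f : M -> R) : Prop :=
  forall c, matlas c -> Cinfty (cmap c @` (W `&` cdom c)) (f \o cinv c).

Definition smooth_mx_on (W : set M) p q (f : M -> 'M[R]_(p, q)) : Prop :=
  forall i j, smooth_on W (fun m => f m i j).

Record triv (F : M -> Type) := Triv {
  tdom : set M;
  trk : nat;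
  tmap : forall m, F m -> 'rV[R]_trk }.

Definition smooth_section_on (F : M -> Type) (T : set (triv F)) (W : set M)
    (s : forall m, F m) : Prop :=
  forall t, T t -> smooth_mx_on (W `&` tdom t) (fun m => tmap t (s m)).

(** In local trivializations, [Phi] is [(m, x) |-> (m, x *m P m + p m)] (resp.
    [(m, x) |-> (m, x *m P m)]) with [P] and [p] smooth. *)
Definition smooth_affine (F G : M -> Type) (t : triv F) (t' : triv G)
    (Phi : forall m, F m -> G m) : Prop :=
  exists (P : M -> 'M[R]_(trk t, trk t')) (p : M -> 'rV[R]_(trk t')),
    [/\ smooth_mx_on (tdom t `&` tdom t') P,
        smooth_mx_on (tdom t `&` tdom t') p &
        forall m, tdom t m -> tdom t' m -> forall a,
          tmap t' (Phi m a) = tmap t a *m P m + p m].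

Definition smooth_linear (F G : M -> Type) (t : triv F) (t' : triv G)
    (Phi : forall m, F m -> G m) : Prop :=
  exists2 P : M -> 'M[R]_(trk t, trk t'),
    smooth_mx_on (tdom t `&` tdom t') P &
    forall m, tdom t m -> tdom t' m -> forall a,
      tmap t' (Phi m a) = tmap t a *m P m.

Record vecdata := VecData {
  vfib :> M -> lmodType R;
  vatlas : set (triv vfib) }.

Arguments vatlas : clear implicits.

Definition is_vtriv (F : M -> lmodType R) (t : triv F) : Prop :=
  open (tdom t) /\
  forall m, tdom t m -> bijective (@tmap _ t m) /\ linear (@tmap _ t m).

Definition is_vector_bundle (E : vecdata) : Prop :=
  [/\ forall t, vatlas E t -> is_vtriv t,
      forall m, exists2 t, vatlas E t & tdom t m &
      forall t t', vatlas E t -> vatlas E t' ->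
        smooth_linear t t' (fun=> id)].

Record affdata := AffData {
  afib :> M -> preaffine R;
  aatlas : set (triv afib) }.

Arguments aatlas : clear implicits.

Definition is_atriv (F : M -> preaffine R) (t : triv F) : Prop :=
  open (tdom t) /\
  forall m, tdom t m -> bijective (@tmap _ t m) /\
    exists2 L : dirv (F m) -> 'rV[R]_(trk t), linear L &
      forall a u, tmap t (act a u) = tmap t a + L u.

Definition is_affine_bundle (A : affdata) : Prop :=
  [/\ forall m, is_affine (A m),
      forall t, aatlas A t -> is_atriv t,
      forall m, exists2 t, aatlas A t & tdom t m &
      forall t t', aatlas A t -> aatlas A t' ->
        smooth_affine t t' (fun=> id)].

Definition vsmooth_on (E : vecdata) := smooth_section_on (vatlas E).
Definition asmooth_on (A : affdata) := smooth_section_on (aatlas A).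

Arguments vsmooth_on : clear implicits.
Arguments asmooth_on : clear implicits.

Definition vsections (E : vecdata) : set (forall m, E m) :=
  [set s | vsmooth_on E setT s].
Definition asections (A : affdata) : set (forall m, A m) :=
  [set s | asmooth_on A setT s].

Arguments vsections : clear implicits.
Arguments asections : clear implicits.

(** The model vector bundle; its trivializations are the linear parts of those
    of [A]. *)
Definition model (A : affdata) : vecdata :=
  @VecData (fun m => dirv (A m))
    [set t | exists c : forall m, A m -> 'rV[R]_(trk t),
       aatlas A (Triv (tdom t) c) /\
       forall m, tdom t m -> forall (a : A m) u,
         c m (act a u) = c m a + tmap t u].

Definition vec_morphism (E F : vecdata) (f : forall m, E m -> F m) : Prop :=
  (forall m, linear (f m)) /\
  forall t t', vatlas E t -> vatlas F t' -> smooth_linear t t' f.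

Definition vec_iso (E F : vecdata) (f : forall m, E m -> F m) : Prop :=
  [/\ is_vector_bundle E, is_vector_bundle F, vec_morphism f &
      exists g : forall m, F m -> E m, vec_morphism g /\
        forall m, cancel (f m) (g m) /\ cancel (g m) (f m)].

Arguments vec_iso : clear implicits.

Definition aff_morphism (A B : affdata) (f : forall m, A m -> B m)
    (fv : forall m, dirv (A m) -> dirv (B m)) : Prop :=
  (forall m, linear (fv m) /\
     forall a u, f m (act a u) = act (f m a) (fv m u)) /\
  forall t t', aatlas A t -> aatlas B t' -> smooth_affine t t' f.

Definition aff_iso (A B : affdata) (f : forall m, A m -> B m)
    (fv : forall m, dirv (A m) -> dirv (B m)) : Prop :=
  aff_morphism f fv /\
  exists (g : forall m, B m -> A m) (gv : forall m, dirv (B m) -> dirv (A m)),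
    aff_morphism g gv /\ forall m, cancel (f m) (g m) /\ cancel (g m) (f m).

Record special_affdata := SpecialAffData {
  saff :> affdata;
  sdist : forall m, dirv (saff m) }.

Definition is_special_affine_bundle (A : special_affdata) : Prop :=
  [/\ is_affine_bundle A, vsections (model A) (@sdist A) &
      forall m, sdist A m <> 0].

Definition special_aff_iso (A B : special_affdata) (f : forall m, A m -> B m)
    (fv : forall m, dirv (A m) -> dirv (B m)) : Prop :=
  [/\ is_special_affine_bundle A, is_special_affine_bundle B, aff_iso f fv &
      forall m, fv m (sdist A m) = sdist B m].

(** For the bundles constructed from others one says which local sections are
    smooth; the local trivializations are then the fibrewise isomorphisms with
    [R^n] for which smoothness of local sections is smoothness of coordinates.
    Local sections are represented by arbitrary extensions to all of [M].
    Sections of [aff_dual A = Aff_M(A; R)] and [lin_dual E = Hom_M(E; R)] are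
    smooth when they are smooth on smooth sections, sections of a quotient when
    they have local smooth lifts, sections of [A^#] when they are smooth in
    [A^dag], and sections of [AS] and [LS] when they map smooth sections of the
    quotient to smooth sections. *)
Definition atlas_of (F : M -> Type) (isT : set (triv F))
    (S : set M -> set (forall m, F m)) : set (triv F) :=
  [set t | isT t /\ forall W, open W -> W `<=` tdom t -> forall s,
     S W s <-> smooth_mx_on W (fun m => tmap t (s m))].

Definition vec_of (F : M -> lmodType R) S : vecdata :=
  @VecData F (atlas_of (@is_vtriv F) S).
Definition aff_of (F : M -> preaffine R) S : affdata :=
  @AffData F (atlas_of (@is_atriv F) S).

Definition aff_dual (A : affdata) : vecdata :=
  vec_of (F := fun m => affun (A m)) (fun W phi =>
    forall W', open W' -> W' `<=` W -> forall a, asmooth_on A W' a ->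
      smooth_on W' (fun m => phi m (a m))).

Definition lin_dual (E : vecdata) : vecdata :=
  vec_of (F := fun m => linform (E m)) (fun W phi =>
    forall W', open W' -> W' `<=` W -> forall e, vsmooth_on E W' e ->
      smooth_on W' (fun m => phi m (e m))).

Definition vec_quo (E : vecdata) (w : forall m, E m) : vecdata :=
  vec_of (F := fun m => vquo (w m)) (fun W q =>
    forall m, W m -> exists2 W', open W' /\ W' m & W' `<=` W /\
      exists2 e, vsmooth_on E W' e &
        forall x, W' x -> vcls (w x) (e x) = q x).

Definition aff_quo (A : special_affdata) : affdata :=
  aff_of (F := fun m => aquo (sdist A m)) (fun W q =>
    forall m, W m -> exists2 W', open W' /\ W' m & W' `<=` W /\
      exists2 a, asmooth_on A W' a &
        forall x, W' x -> acls (sdist A x) (a x) = q x).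

Definition dag (A : special_affdata) : vecdata := aff_dual A.

Definition dag1 (A : special_affdata) (m : M) : dag A m := affun1 (A m).

Definition sharp_bundle (A : special_affdata) : special_affdata :=
  @SpecialAffData
    (aff_of (F := fun m => sharp (sdist A m)) (fun W phi =>
       vsmooth_on (dag A) W (fun m => val (phi m))))
    (fun m => sharp1 (sdist A m)).

(** [AS B] is meant for [B = A^#], and [LS A] is [LS(A^dag)]: the
    distinguished section of the latter involves that of [A]. *)
Definition AS (B : special_affdata) : special_affdata :=
  @SpecialAffData
    (aff_of (F := fun m => asec (sdist B m)) (fun W s =>
       forall W', open W' -> W' `<=` W -> forall q,
         asmooth_on (aff_quo B) W' q ->
         asmooth_on B W' (fun m => val (s m) (q m))))
    (fun m => - affun1 (aquo (sdist B m))).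

Definition LS (A : special_affdata) : special_affdata :=
  @SpecialAffData
    (aff_of (F := fun m => lsec (dag1 A m)) (fun W s =>
       forall W', open W' -> W' `<=` W -> forall q,
         vsmooth_on (vec_quo (dag1 A)) W' q ->
         vsmooth_on (dag A) W' (fun m => val (s m) (q m))))
    (fun m => - iota_dag (sdist A m)).

End Bundles.

Arguments vecdata {R d} M.
Arguments affdata {R d} M.
Arguments special_affdata {R d} M.
Arguments vsections {R d M} E.
Arguments asections {R d M} A.
Arguments vec_iso {R d M} E F f.

(* Main.v *)
Require Import Defs.
From HB Require Import structures.
From mathcomp Require Import all_boot all_order all_algebra.
From mathcomp Require Import all_classical all_reals all_analysis.
Import GRing.Theory.
Import numFieldNormedType.Exports.
Local Open Scope classical_set_scope.
Local Open Scope ring_scope.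

Set Implicit Arguments.
Unset Strict Implicit.
Unset Printing Implicit Defensive.

(** A point [a] gives the sections [phi |-> phi - phi(a) 1_A] of both
    quotients, and [u] acts on them by [- iota u]; injectivity, surjectivity and
    smoothness are then read off in coordinates.  Around every point there is a
    trivialization [(x0, x)] of [A] in which [v0] is the first basis vector.  It
    induces coordinates [(c, l0, l)] of [phi = c + l0 x0 + l x] on [A^dag],
    [(c, l)] on [A^#] (where [l0 = 1]), [(l0, l)] and [l] on the quotients by
    [1_A], and finally coordinates of the sections of the latter, seen as graphs:
    the section of [A^#] given by [a] is [l |-> (- x0 - l x, l)], so it has
    coordinates [(x0, x)] up to sign.  Hence in suitable trivializations all the
    isomorphisms become the identity, up to sign.  A fibrewise affine map is
    smooth as soon as it maps smooth local sections to smooth local sections, so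
    nothing has to be checked in other trivializations. *)

(** * Smooth functions *)

Section CkTheory.
Context {R : realType} {d : nat}.
Implicit Types (D : set 'rV[R]_d) (f g : 'rV[R]_d -> R).

(** The atlases of the constructed bundles are characterized rather than listed: they contain every
    trivialization in which smoothness of sections is smoothness of coordinates. So each bundle
    needs only one such trivialization around every point. The transition functions are then smooth
    because their matrices come from images of frames with constant coordinates, and these frames
    are smooth sections. The adapted trivializations of [A] need not belong to its given atlas,
    whence the notion [smooth_triv]. They exist because a coordinate of [v0] that is nonzero at a
    point stays nonzero nearby; this also makes the fibres of [A^#] nonempty, while those of [AS]
    and [LS] are nonempty because points of [A] define sections. The isomorphism from [AS] to [LS]
    is not built by extending affine sections to linear ones: it is the composite through [A].
    Inverses must therefore be as easy to handle as the maps, which is why smoothness of a map is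
    expressed as an equivalence between smoothness of a section and of its image. *)

Lemma open_near_eq D f g x : open D -> {in D, f =1 g} -> D x ->
  \forall y \near x, f y = g y.
Proof.
move=> oD fg Dx; have := open_nbhs_nbhs (conj oD Dx).
by apply: filterS => y Dy; apply: fg; rewrite inE.
Qed.

Lemma near_continuous f g (x : 'rV[R]_d) : (\forall y \near x, f y = g y) ->
  {for x, continuous f} -> {for x, continuous g}.
Proof.
move=> fg cf; suff : g @ x --> f x by rewrite (nbhs_singleton fg).
apply: cvg_trans cf; exact: (@near_eq_cvg _ _ (nbhs x)).
Qed.

(** As [D] is open, [f] and [g] have the same germ at each of its points, so continuity and
    derivability transfer, and the partial derivatives again agree on [D]. *)
Lemma Ck_ext k D f g : open D -> {in D, f =1 g} -> Ck k D f -> Ck k D g.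
Proof.
move=> oD; elim: k f g => [|k IH] f g fg /=.
  move=> [cf _]; split=> // x Dx.
  exact: near_continuous (open_near_eq oD fg Dx) (cf x Dx).
move=> [cf df]; split=> [x Dx|i].
  exact: near_continuous (open_near_eq oD fg Dx) (cf x Dx).
have [h1 h2] := df i; split=> [x Dx|].
  exact: near_eq_derivable (open_near_eq oD fg Dx) (h1 x Dx).
apply: IH h2 => x; rewrite inE => Dx.
exact/near_eq_derive/(open_near_eq oD fg Dx).
Qed.

Lemma Ck_cont k D f : Ck k D f -> forall x, D x -> {for x, continuous f}.
Proof. by case: k => [|k] []. Qed.

Lemma CkW k D f : Ck k.+1 D f -> Ck k D f.
Proof.
elim: k f => [|k IH] f [cf df]; split=> // i.
by have [h1 h2] := df i; split=> //; apply: IH.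
Qed.

(** Every clause of [Ck] is a condition at single points of [D] on a function defined everywhere, so
    arbitrary sets [D'] can be glued. *)
Lemma Ck_local k D f :
  (forall x, D x -> exists2 D', D' x & Ck k D' f) -> Ck k D f.
Proof.
elim: k f => [|k IH] f h.
  by split=> // x /h[D' D'x] [cf _]; apply: cf.
split=> [x /h[D' D'x] [cf _]|i]; first exact: cf.
split=> [x /h[D' D'x] [_ /(_ i)[df _]]|]; first exact: df.
by apply: IH => x /h[D' D'x] [_ /(_ i)[_ df]]; exists D'.
Qed.

Lemma Ck_cst k D (c : R) : Ck k D (fun=> c).
Proof.
elim: k c => [|k IH] c; (split=> [x _|]; first exact: cst_continuous) => // i.
split=> [x _|].
  exact: derivable_cst.
suff -> : (fun x : 'rV[R]_d => 'D_(delta_mx 0 i) (fun=> c) x) = fun=> 0 by [].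
by apply/funext => x; exact: derive_cst.
Qed.

Lemma CkD k D f g : open D -> Ck k D f -> Ck k D g ->
  Ck k D (fun x => f x + g x).
Proof.
move=> oD; elim: k f g => [|k IH] f g [cf df] [cg dg].
  by split=> // x Dx; apply: continuousD; [exact: cf|exact: cg].
split=> [x Dx|i]; first by apply: continuousD; [exact: cf|exact: cg].
have [f1 f2] := df i; have [g1 g2] := dg i; split=> [x Dx|].
  by apply: derivableD; [exact: f1|exact: g1].
apply: Ck_ext (IH _ _ f2 g2) => // x; rewrite inE => Dx /=.
by rewrite deriveD //; [exact: f1|exact: g1].
Qed.

(** Leibniz rule; [CkW] lowers the order of the factor that is not differentiated, so that the
    induction hypothesis applies to both products. *)
Lemma CkM k D f g : open D -> Ck k D f -> Ck k D g ->
  Ck k D (fun x => f x * g x).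
Proof.
move=> oD; elim: k f g => [|k IH] f g Cf Cg.
  split=> // x Dx; apply: continuousM; first exact: (Ck_cont Cf).
  exact: (Ck_cont Cg).
have [cf df] := Cf; have [cg dg] := Cg; split=> [x Dx|i].
  by apply: continuousM; [exact: cf|exact: cg].
have [f1 f2] := df i; have [g1 g2] := dg i; split=> [x Dx|].
  by apply: derivableM; [exact: f1|exact: g1].
have h := CkD oD (IH _ _ (CkW Cf) g2) (IH _ _ (CkW Cg) f2).
apply: Ck_ext h => // x; rewrite inE => Dx /=.
by rewrite (deriveM (f1 x Dx) (g1 x Dx)).
Qed.

(** The derivative of [1/f] is [- (1/f)^2 f'], a product of functions of class [k] by induction. *)
Lemma CkV k D f : open D -> (forall x, D x -> f x != 0) -> Ck k D f ->
  Ck k D (fun x => (f x)^-1).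
Proof.
move=> oD f0; elim: k => [|k IH] Cf.
  by split=> // x Dx; apply: continuousV; [exact: f0|exact: (Ck_cont Cf)].
have [cf df] := Cf; split=> [x Dx|i].
  by apply: continuousV; [exact: f0|exact: cf].
have [f1 f2] := df i; split=> [x Dx|].
  by apply: derivableV; [exact: f0|exact: f1].
have V := IH (CkW Cf).
have h := CkM oD (Ck_cst k D (-1)) (CkM oD (CkM oD V V) f2).
apply: Ck_ext h => // x; rewrite inE => Dx /=.
by rewrite (deriveV (f0 x Dx) (f1 x Dx)) -exprVn expr2 mulN1r scaleNr.
Qed.

End CkTheory.

Section SmoothOn.
Context {R : realType} {d : nat} {M : manifold R d}.
Implicit Types (W : set M) (f g : M -> R).

(** Inside the open image of [cdom c], this set is the preimage of [W] under the continuous map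
    [cinv c]. *)
Lemma chart_image_open (c : chart (R := R) d M) W : is_chart c -> open W ->
  open (cmap c @` (W `&` cdom c)).
Proof.
move=> [oc oi cK _ ci] oW.
rewrite openE => _ [m [Wm cm] <-].
have Um : (cmap c @` cdom c) (cmap c m) by exists m.
move: ci; rewrite continuous_open_subspace // => /(_ (cmap c m)).
rewrite inE => /(_ Um) /(_ W); rewrite cK // => /(_ (open_nbhs_nbhs (conj oW Wm))) h.
apply: filterS2 (open_nbhs_nbhs (conj oi Um)) h => _ [y cy <-] /=.
by rewrite /= cK // => Wy; exists y.
Qed.

Lemma smooth_ext W f g : open W -> (forall m, W m -> f m = g m) ->
  smooth_on W f -> smooth_on W g.
Proof.
move=> oW fg sf c cA k; apply: Ck_ext (sf c cA k).
  by apply: chart_image_open oW; exact: mchart.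
move=> _ /set_mem[m [Wm cm] <-] /=.
by have [_ _ cK _ _] := mchart cA; rewrite cK // fg.
Qed.

Lemma smooth_local W f :
  (forall m, W m -> exists2 W', W' m & smooth_on W' f) -> smooth_on W f.
Proof.
move=> h c cA k; apply: Ck_local => _ [m [Wm cm] <-].
have [W' W'm sf] := h m Wm.
by exists (cmap c @` (W' `&` cdom c)); [exists m|exact: sf].
Qed.

Lemma smooth_sub W W' f : W' `<=` W -> smooth_on W f -> smooth_on W' f.
Proof. by move=> sub sf; apply: smooth_local => m /sub Wm; exists W. Qed.

Lemma smooth_cst W (c : R) : smooth_on W (fun=> c).
Proof. by move=> e eA k; exact: Ck_cst. Qed.

Lemma smoothD W f g : open W -> smooth_on W f -> smooth_on W g ->
  smooth_on W (fun m => f m + g m).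
Proof.
move=> oW sf sg c cA k; apply: CkD; [|exact: sf|exact: sg].
by apply: chart_image_open oW; exact: mchart.
Qed.

Lemma smoothM W f g : open W -> smooth_on W f -> smooth_on W g ->
  smooth_on W (fun m => f m * g m).
Proof.
move=> oW sf sg c cA k; apply: CkM; [|exact: sf|exact: sg].
by apply: chart_image_open oW; exact: mchart.
Qed.

Lemma smoothN W f : open W -> smooth_on W f -> smooth_on W (fun m => - f m).
Proof.
move=> oW sf; apply: smooth_ext (smoothM oW (smooth_cst W (-1)) sf) => // m _.
by rewrite mulN1r.
Qed.

Lemma smoothB W f g : open W -> smooth_on W f -> smooth_on W g ->
  smooth_on W (fun m => f m - g m).
Proof. by move=> oW sf sg; apply: smoothD => //; apply: smoothN. Qed.

Lemma smoothV W f : open W -> (forall m, W m -> f m != 0) ->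
  smooth_on W f -> smooth_on W (fun m => (f m)^-1).
Proof.
move=> oW f0 sf c cA k; apply: CkV; last exact: sf.
  by apply: chart_image_open oW; exact: mchart.
have [_ _ cK _ _] := mchart cA.
by move=> _ [m [Wm cm] <-] /=; rewrite cK // f0.
Qed.

Lemma smooth_sum W n (f : 'I_n -> M -> R) : open W ->
  (forall i, smooth_on W (f i)) -> smooth_on W (fun m => \sum_i f i m).
Proof.
move=> oW; elim: n f => [|n IH] f sf.
  by apply: smooth_ext (smooth_cst W 0) => // m _; rewrite big_ord0.
apply: smooth_ext (smoothD oW (sf ord0) (IH _ (fun i => sf (lift ord0 i)))) => //.
by move=> m _; rewrite big_ord_recl.
Qed.

Lemma smooth_continuous W f m : open W -> smooth_on W f -> W m ->
  {for m, continuous f}.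
Proof.
move=> oW sf Wm; have [c cA cm] := mcover m.
have [oc _ cK cc _] := mchart cA.
have [/(_ (cmap c m)) h _] := sf c cA 0%N.
have {}h : {for cmap c m, continuous (f \o cinv c)}.
  by apply: h; exists m.
move: cc; rewrite continuous_open_subspace // => /(_ m).
rewrite inE => /(_ cm) cc.
have fE : \forall x \near m, ((f \o cinv c) \o cmap c) x = f x.
  by apply: filterS (open_nbhs_nbhs (conj oc cm)) => x cx /=; rewrite cK.
have {}h := continuous_comp cc h.
suff : f @ m --> ((f \o cinv c) \o cmap c) m by rewrite /= cK.
apply: (cvg_trans _ h); exact: (@near_eq_cvg _ _ (nbhs m)).
Qed.

(** Used to shrink the domain of a trivialization to the points where a chosen coordinate of [v0]
    does not vanish. *)
Lemma open_neq0 W f : open W -> smooth_on W f ->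
  open (W `&` [set m | f m != 0]).
Proof.
move=> oW sf; rewrite openE => m [Wm fm].
have h := smooth_continuous oW sf Wm.
have h0 : nbhs (f m) [set y | y != 0].
  by apply: open_nbhs_nbhs; split=> //; exact: open_neq.
by apply: filterS2 (open_nbhs_nbhs (conj oW Wm)) (h _ h0).
Qed.

Section Mx.
Variables (p q : nat).
Implicit Types F G : M -> 'M[R]_(p, q).

Lemma smooth_mx_ext W F G : open W -> (forall m, W m -> F m = G m) ->
  smooth_mx_on W F -> smooth_mx_on W G.
Proof.
by move=> oW FG sF i j; apply: smooth_ext (sF i j) => // m Wm; rewrite FG.
Qed.

Lemma smooth_mx_local W F :
  (forall m, W m -> exists2 W', W' m & smooth_mx_on W' F) -> smooth_mx_on W F.
Proof.
by move=> h i j; apply: smooth_local => m /h[W' W'm sF]; exists W'.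
Qed.

Lemma smooth_mx_sub W W' F : W' `<=` W -> smooth_mx_on W F -> smooth_mx_on W' F.
Proof. by move=> sub sF i j; exact: smooth_sub (sF i j). Qed.

Lemma smooth_mx_cst W (C : 'M[R]_(p, q)) : smooth_mx_on W (fun=> C).
Proof. by move=> i j; exact: smooth_cst. Qed.

Lemma smooth_mxD W F G : open W -> smooth_mx_on W F -> smooth_mx_on W G ->
  smooth_mx_on W (fun m => F m + G m).
Proof.
move=> oW sF sG i j; apply: smooth_ext (smoothD oW (sF i j) (sG i j)) => // m _.
by rewrite mxE.
Qed.

Lemma smooth_mxN W F : open W -> smooth_mx_on W F ->
  smooth_mx_on W (fun m => - F m).
Proof.
move=> oW sF i j; apply: smooth_ext (smoothN oW (sF i j)) => // m _.
by rewrite mxE.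
Qed.

Lemma smooth_mxNP W F : open W ->
  smooth_mx_on W (fun m => - F m) <-> smooth_mx_on W F.
Proof.
move=> oW; split; last exact: smooth_mxN.
by move=> /(smooth_mxN oW); apply: smooth_mx_ext => // m _; rewrite opprK.
Qed.

Lemma smooth_mxB W F G : open W -> smooth_mx_on W F -> smooth_mx_on W G ->
  smooth_mx_on W (fun m => F m - G m).
Proof. by move=> oW sF sG; apply: smooth_mxD => //; apply: smooth_mxN. Qed.

End Mx.

Lemma smooth_mxM W p q r (F : M -> 'M[R]_(p, q)) (G : M -> 'M[R]_(q, r)) :
  open W -> smooth_mx_on W F -> smooth_mx_on W G ->
  smooth_mx_on W (fun m => F m *m G m).
Proof.
move=> oW sF sG i j.
apply: (@smooth_ext _ (fun m => \sum_k F m i k * G m k j)) => //.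
  by move=> m _; rewrite mxE.
by apply: smooth_sum => // k; apply: smoothM.
Qed.

Lemma smooth_row_mxP W p q (F : M -> 'rV[R]_p) (G : M -> 'rV[R]_q) : open W ->
  smooth_mx_on W (fun m => row_mx (F m) (G m)) <->
  smooth_mx_on W F /\ smooth_mx_on W G.
Proof.
move=> oW; split=> [s|[sF sG] i j].
  split=> i j.
    by apply: smooth_ext (s i (lshift q j)) => // m _; rewrite row_mxEl.
  by apply: smooth_ext (s i (rshift p j)) => // m _; rewrite row_mxEr.
case: (fintype.split_ordP j) => k ->.
  by apply: smooth_ext (sF i k) => // m _; rewrite row_mxEl.
by apply: smooth_ext (sG i k) => // m _; rewrite row_mxEr.
Qed.

End SmoothOn.

(** * Smooth sections and trivializations *)

Section Fibres.
Context {R : realType}.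

Section Linear.
Variables (V V' : lmodType R) (f : V -> V').
Hypothesis lf : linear f.

Lemma linear_prop0 : f 0 = 0.
Proof. by have := lf (-1) 0 0; rewrite scaler0 addr0 scaleN1r addNr. Qed.

Lemma linear_propD u v : f (u + v) = f u + f v.
Proof. by have := lf 1 u v; rewrite !scale1r. Qed.

Lemma linear_propZ a u : f (a *: u) = a *: f u.
Proof. by have := lf a u 0; rewrite linear_prop0 !addr0. Qed.

Lemma linear_propB u v : f (u - v) = f u - f v.
Proof. by rewrite addrC -scaleN1r lf scaleN1r addrC. Qed.

Lemma linear_prop_sum n (a : 'I_n -> R) (v : 'I_n -> V) :
  f (\sum_i a i *: v i) = \sum_i a i *: f (v i).
Proof.
elim: n a v => [|n IH] a v; first by rewrite !big_ord0 linear_prop0.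
by rewrite !big_ord_recl lf IH.
Qed.

End Linear.

Lemma linear_comp (V1 V2 V3 : lmodType R) (f : V1 -> V2) (g : V2 -> V3) :
  linear f -> linear g -> linear (g \o f).
Proof. by move=> lf lg c u v /=; rewrite lf lg. Qed.

(** The vector [u] and the combination of the [e j] with coefficients [c u 0 j] have the same
    coordinates, hence coincide. *)
Lemma linear_expand (V V' : lmodType R) k (c : V -> 'rV[R]_k) (e : 'I_k -> V)
    (g : V -> V') :
  linear c -> injective c -> (forall j, c (e j) = delta_mx 0 j) -> linear g ->
  forall u, g u = \sum_j c u 0 j *: g (e j).
Proof.
move=> lc ci ce lg u; rewrite -linear_prop_sum //; congr g.
apply: ci; rewrite linear_prop_sum // {1}[c u]row_sum_delta.
by apply: eq_bigr => j _; rewrite ce.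
Qed.

Lemma mul_rowsE k l (x : 'rV[R]_k) (h : 'I_k -> 'rV[R]_l) :
  x *m \matrix_(i, j) h i 0 j = \sum_i x 0 i *: h i.
Proof.
by apply/rowP => j; rewrite mxE summxE; apply: eq_bigr => i _; rewrite !mxE.
Qed.

Section Affine.
Variables (B : preaffine R).
Hypothesis aB : is_affine B.

Lemma act_inj (a : B) : injective (act a).
Proof.
move=> u u' h; have [w [_ wu]] := aB.2 a (act a u).
by rewrite -(wu u) // -(wu u').
Qed.

Lemma act_surj (a b : B) : exists u, b = act a u.
Proof. by have [w [h _]] := aB.2 a b; exists w. Qed.

Variables (k : nat) (c : B -> 'rV[R]_k) (L : dirv B -> 'rV[R]_k).
Hypotheses (cb : bijective c) (cL : forall a u, c (act a u) = c a + L u).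

Lemma linpart_inj : injective L.
Proof.
move=> u u' h; have [a _] := aB.1; apply: (@act_inj a); apply: (bij_inj cb).
by rewrite !cL h.
Qed.

Lemma linpart_surj x : exists u, L u = x.
Proof.
have [a _] := aB.1; have [c' _ cK'] := cb.
have [u h] := act_surj a (c' (c a + x)); exists u.
by apply: (@addrI _ (c a)); rewrite -cL -h cK'.
Qed.

Lemma linpart_bij : bijective L.
Proof.
pose g x := proj1_sig (cid (linpart_surj x)).
have gK x : L (g x) = x by rewrite /g; case: cid.
by exists g => // u; apply: linpart_inj; rewrite gK.
Qed.

(** Writing [p j] as [o] translated by [e j] turns the [e j] into a basis with coordinates
    [delta_mx 0 j], and [linear_expand] applies to the linear part. *)
Lemma affine_expand (V : lmodType R) (f : B -> V) (g : dirv B -> V)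
    (o : B) (p : 'I_k -> B) :
  linear L -> linear g -> (forall a u, f (act a u) = f a + g u) ->
  c o = 0 -> (forall j, c (p j) = delta_mx 0 j) ->
  forall a, f a = f o + \sum_j c a 0 j *: (f (p j) - f o).
Proof.
move=> lL lg fg co cp a.
have [e pe] := choice (fun j => act_surj o (p j)).
have ce j : L (e j) = delta_mx 0 j by rewrite -cp pe cL co add0r.
have [u ->] := act_surj o a.
rewrite fg cL co add0r (linear_expand lL linpart_inj ce lg); congr (_ + _).
by apply: eq_bigr => j _; rewrite pe fg addrC addKr.
Qed.

End Affine.
End Fibres.

(** * Smoothness tested on local sections *)

Section Trivializations.
Context {R : realType} {d : nat} {M : manifold R d}.

(** Membership in [T] is deliberately left out: an atlas is not assumed maximal, and the adapted
    trivializations of [A] are only known to detect its smooth sections. *)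
Definition smooth_triv (F : M -> Type) (T : set (triv F)) (t : triv F) : Prop :=
  open (tdom t) /\ forall W, open W -> W `<=` tdom t -> forall s,
    smooth_section_on T W s <-> smooth_mx_on W (fun m => tmap t (s m)).

Lemma section_on_sub (F : M -> Type) (T : set (triv F)) W W' s :
  W' `<=` W -> smooth_section_on T W s -> smooth_section_on T W' s.
Proof.
move=> sub h t tT; apply: smooth_mx_sub (h t tT).
by move=> m [/sub Wm tm].
Qed.

Lemma section_on_local (F : M -> Type) (T : set (triv F)) W s :
  (forall m, W m -> exists2 W', W' m & smooth_section_on T W' s) ->
  smooth_section_on T W s.
Proof.
move=> h t tT; apply: smooth_mx_local => m [/h[W' W'm sW'] tm].
by exists (W' `&` tdom t); [split|exact: sW'].
Qed.

Lemma smooth_triv_of_mem (F : M -> Type) (T : set (triv F)) t :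
  T t -> open (tdom t) ->
  (forall W, open W -> W `<=` tdom t -> forall s,
    smooth_mx_on W (fun m => tmap t (s m)) -> smooth_section_on T W s) ->
  smooth_triv T t.
Proof.
move=> tT ot h; split=> // W oW sub s; split; last exact: h.
by move=> /(_ t tT); rewrite setIidl.
Qed.

(** On the overlap with another member [t'], the predicate [S] mediates: smoothness of the
    coordinates in [t] and in [t'] are both equivalent to it. *)
Lemma atlas_of_smooth (F : M -> Type) (isT : set (triv F)) S t :
  (forall t, isT t -> open (tdom t)) -> atlas_of isT S t ->
  smooth_triv (atlas_of isT S) t.
Proof.
move=> op tA; have [/op ot tS] := tA; apply: smooth_triv_of_mem => //.
move=> W oW sub s sW t' [/op ot' t'S].
have oI : open (W `&` tdom t') by exact: openI.
apply/t'S => //; apply/tS => //; last by apply: smooth_mx_sub sW.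
by move=> m [/sub].
Qed.

Lemma sections_with_coords (F : M -> Type) (t : triv F) (x : M -> 'rV[R]_(trk t)) :
  (forall m, inhabited (F m)) ->
  (forall m, tdom t m -> exists a : F m, tmap t a = x m) ->
  exists s : forall m, F m, forall m, tdom t m -> tmap t (s m) = x m.
Proof.
move=> inhF ex; have h m : exists a : F m, tdom t m -> tmap t a = x m.
  have [tm|ntm] := pselect (tdom t m); last by have [a] := inhF m; exists a.
  by have [a ha] := ex m tm; exists a.
by exists (fun m => sval (cid (h m))) => m; exact: svalP (cid (h m)).
Qed.

Lemma inhabited_affine (F : M -> preaffine R) :
  (forall m, is_affine (F m)) -> forall m, inhabited (F m).
Proof. by move=> aF m; have [[a _] _] := aF m. Qed.

Lemma inhabited_vector (F : M -> lmodType R) m : inhabited (F m).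
Proof. by split; exact: 0. Qed.

Lemma frame_vector (F : M -> lmodType R) (t : triv F) : is_vtriv t ->
  exists e : 'I_(trk t) -> forall m, F m,
    forall j m, tdom t m -> tmap t (e j m) = delta_mx 0 j.
Proof.
move=> [_ vt]; suff h (j : 'I_(trk t)) : exists s : forall m, F m,
    forall m, tdom t m -> tmap t (s m) = delta_mx 0 j.
  by exists (fun j => sval (cid (h j))) => j; exact: svalP (cid (h j)).
apply: (sections_with_coords (x := fun=> delta_mx 0 j) (@inhabited_vector F)) => m tm.
by have [[g _ gK] _] := vt m tm; exists (g (delta_mx 0 j)).
Qed.

Lemma section_affine (F : M -> preaffine R) (t : triv F) :
  (forall m, is_affine (F m)) -> is_atriv t -> forall x : M -> 'rV[R]_(trk t),
  exists s : forall m, F m, forall m, tdom t m -> tmap t (s m) = x m.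
Proof.
move=> aF [_ vt] x; apply: sections_with_coords => [|m tm].
  exact: inhabited_affine.
by have [[g _ gK] _] := vt m tm; exists (g (x m)).
Qed.

Lemma frame_affine (F : M -> preaffine R) (t : triv F) :
  (forall m, is_affine (F m)) -> is_atriv t ->
  exists e : 'I_(trk t) -> forall m, F m,
    forall j m, tdom t m -> tmap t (e j m) = delta_mx 0 j.
Proof.
move=> aF vt; suff h (j : 'I_(trk t)) : exists s : forall m, F m,
    forall m, tdom t m -> tmap t (s m) = delta_mx 0 j.
  by exists (fun j => sval (cid (h j))) => j; exact: svalP (cid (h j)).
exact: (section_affine aF vt (fun=> delta_mx 0 j)).
Qed.

Lemma smooth_rows W k l (h : 'I_k -> M -> 'rV[R]_l) :
  (forall j, smooth_mx_on W (h j)) ->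
  smooth_mx_on W (fun m => \matrix_(i, j) h i m 0 j).
Proof.
move=> sh i j; rewrite (_ : (fun m => _) = fun m => h i m 0 j); first exact: sh.
by apply/funext => m; rewrite mxE.
Qed.

(** The rows of the matrix of [f] are the coordinates of the images of a frame. The frame has
    constant coordinates, so the hypothesis on sections applies to it. *)
Lemma smooth_linearP (F G : M -> lmodType R) (t : triv F) (t' : triv G)
    (f : forall m, F m -> G m) :
  is_vtriv t -> is_vtriv t' -> (forall m, linear (f m)) ->
  (forall s : forall m, F m,
    smooth_mx_on (tdom t `&` tdom t') (fun m => tmap t (s m)) ->
    smooth_mx_on (tdom t `&` tdom t') (fun m => tmap t' (f m (s m)))) ->
  smooth_linear t t' f.
Proof.
move=> vt vt' lf h; have [e te] := frame_vector vt.
have oI : open (tdom t `&` tdom t') by apply: openI; [case: vt|case: vt'].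
exists (fun m => \matrix_(i, j) (tmap t' (f m (e i m))) 0 j).
  apply: smooth_rows => j; apply: h.
  by apply: smooth_mx_ext (smooth_mx_cst _ (delta_mx 0 j)) => // m [/te->].
move=> m tm t'm a; rewrite mul_rowsE.
have [_ /(_ m tm)[tb lt]] := vt; have [_ /(_ m t'm)[_ lt']] := vt'.
apply: (linear_expand (g := fun u => tmap t' (f m u)) lt (bij_inj tb)) => [j|].
  exact: te.
exact: (linear_comp (lf m) lt').
Qed.

(** As for linear maps, with an origin: the translation term is the image of the section [b0] of
    zero coordinates, and the rows are the images of the frame minus this term. *)
Lemma smooth_affineP (F G : M -> preaffine R) (t : triv F) (t' : triv G)
    (f : forall m, F m -> G m) (fv : forall m, dirv (F m) -> dirv (G m)) :
  (forall m, is_affine (F m)) -> is_atriv t -> is_atriv t' ->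
  (forall m, linear (fv m) /\ forall a u, f m (act a u) = act (f m a) (fv m u)) ->
  (forall s : forall m, F m,
    smooth_mx_on (tdom t `&` tdom t') (fun m => tmap t (s m)) ->
    smooth_mx_on (tdom t `&` tdom t') (fun m => tmap t' (f m (s m)))) ->
  smooth_affine t t' f.
Proof.
move=> aF vt vt' lf h; have [e te] := frame_affine aF vt.
have [b0 tb0] := section_affine aF vt (fun=> 0).
have oI : open (tdom t `&` tdom t') by apply: openI; [case: vt|case: vt'].
have smo : smooth_mx_on (tdom t `&` tdom t') (fun m => tmap t' (f m (b0 m))).
  by apply: h; apply: smooth_mx_ext (smooth_mx_cst _ 0) => // m [/tb0->].
exists (fun m => \matrix_(i, j) (tmap t' (f m (e i m)) - tmap t' (f m (b0 m))) 0 j).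
exists (fun m => tmap t' (f m (b0 m))); split=> //.
  apply: smooth_rows => j; apply: smooth_mxB => //; apply: h.
  by apply: smooth_mx_ext (smooth_mx_cst _ (delta_mx 0 j)) => // m [/te->].
move=> m tm t'm a; rewrite mul_rowsE addrC.
have [_ /(_ m tm)[tb [L lL tL]]] := vt.
have [_ /(_ m t'm)[_ [L' lL' tL']]] := vt'.
have [lfv fa] := lf m.
apply: (@affine_expand _ _ (aF m) _ _ _ tb tL _ (fun x => tmap t' (f m x)) _
  (b0 m) (e^~ m) lL (linear_comp lfv lL')) => [b u||j].
- by rewrite fa tL'.
- exact: tb0.
- exact: te.
Qed.

Lemma aatlas_smooth (A : affdata M) t :
  is_affine_bundle A -> aatlas t -> smooth_triv (@aatlas _ _ _ A) t.
Proof.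
move=> [_ triA _ trA] tA; have [ot _] := triA t tA.
apply: smooth_triv_of_mem => // W oW sub s sW t' t'A.
have [P [p [sP sp tP]]] := trA t t' tA t'A.
have [ot' _] := triA t' t'A.
have oI : open (W `&` tdom t') by exact: openI.
have sI : W `&` tdom t' `<=` tdom t `&` tdom t' by move=> m [/sub].
apply: (@smooth_mx_ext _ _ _ _ _ _ (fun m => tmap t (s m) *m P m + p m)) => //.
  by move=> m [/sub tm t'm]; rewrite tP.
apply: smooth_mxD => //; last exact: smooth_mx_sub sp.
apply: smooth_mxM => //; last exact: smooth_mx_sub sP.
by apply: smooth_mx_sub sW => m [].
Qed.

Lemma vatlas_smooth (E : vecdata M) t :
  is_vector_bundle E -> vatlas t -> smooth_triv (@vatlas _ _ _ E) t.
Proof.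
move=> [triA _ trA] tA; have [ot _] := triA t tA.
apply: smooth_triv_of_mem => // W oW sub s sW t' t'A.
have [P sP tP] := trA t t' tA t'A.
have [ot' _] := triA t' t'A.
have oI : open (W `&` tdom t') by exact: openI.
have sI : W `&` tdom t' `<=` tdom t `&` tdom t' by move=> m [/sub].
apply: (@smooth_mx_ext _ _ _ _ _ _ (fun m => tmap t (s m) *m P m)) => //.
  by move=> m [/sub tm t'm]; rewrite tP.
apply: smooth_mxM => //; last exact: smooth_mx_sub sP.
by apply: smooth_mx_sub sW => m [].
Qed.

Lemma linear_id (V : lmodType R) : linear (fun u : V => u).
Proof. by []. Qed.

(** A transition function is the identity read in two trivializations. Both detect the same smooth
    sections, so [smooth_linearP] makes it smooth. *)
Lemma vector_bundle_of_smooth (E : vecdata M) :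
  (forall t, @vatlas _ _ _ E t -> is_vtriv t) ->
  (forall t, @vatlas _ _ _ E t -> smooth_triv (@vatlas _ _ _ E) t) ->
  (forall m, exists2 t, @vatlas _ _ _ E t & tdom t m) ->
  is_vector_bundle E.
Proof.
move=> hv hs hc; split=> // t t' tE t'E.
have [ot ht] := hs t tE; have [ot' ht'] := hs t' t'E.
apply: smooth_linearP; [exact: hv|exact: hv|by move=> m; exact: linear_id|].
move=> s /(ht _ (openI ot ot')) h.
apply/(ht' _ (openI ot ot')); first by move=> m [].
by apply: h => m [].
Qed.

Lemma affine_bundle_of_smooth (A : affdata M) :
  (forall m, is_affine (A m)) ->
  (forall t, @aatlas _ _ _ A t -> is_atriv t) ->
  (forall t, @aatlas _ _ _ A t -> smooth_triv (@aatlas _ _ _ A) t) ->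
  (forall m, exists2 t, @aatlas _ _ _ A t & tdom t m) ->
  is_affine_bundle A.
Proof.
move=> aA hv hs hc; split=> // t t' tE t'E.
have [ot ht] := hs t tE; have [ot' ht'] := hs t' t'E.
apply: (smooth_affineP (fv := fun _ u => u)) => //; [exact: hv|exact: hv|].
move=> s /(ht _ (openI ot ot')) h.
apply/(ht' _ (openI ot ot')); first by move=> m [].
by apply: h => m [].
Qed.

Lemma vec_of_smooth (F : M -> lmodType R) S t :
  vatlas t -> smooth_triv (@vatlas _ _ _ (@vec_of _ _ _ F S)) t.
Proof. by move=> tE; apply: atlas_of_smooth => // t' []. Qed.

Lemma aff_of_smooth (F : M -> preaffine R) S t :
  aatlas t -> smooth_triv (@aatlas _ _ _ (@aff_of _ _ _ F S)) t.
Proof. by move=> tE; apply: atlas_of_smooth => // t' []. Qed.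

(** Smooth transitions come for free for a bundle defined by its smooth sections; what remains is a
    trivialization around each point. *)
Lemma vec_of_bundle (F : M -> lmodType R) S :
  (forall m, exists2 t : triv F, atlas_of (@is_vtriv _ _ _ F) S t & tdom t m) ->
  is_vector_bundle (vec_of S).
Proof.
move=> hc; apply: vector_bundle_of_smooth => // t; first by case.
exact: vec_of_smooth.
Qed.

Lemma aff_of_bundle (F : M -> preaffine R) S :
  (forall m, is_affine (F m)) ->
  (forall m, exists2 t : triv F, atlas_of (@is_atriv _ _ _ F) S t & tdom t m) ->
  is_affine_bundle (aff_of S).
Proof.
move=> aF hc; apply: affine_bundle_of_smooth => // t; first by case.
exact: aff_of_smooth.
Qed.

(** Smoothness of sections is local, so suitable pairs of trivializations around each point suffice.
    The equivalence covers [f] and its inverse at once. *)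
Lemma section_transport (F G : M -> Type) (T : set (triv F)) (T' : set (triv G))
    (f : forall m, F m -> G m) :
  (forall m, exists t t', [/\ smooth_triv T t, smooth_triv T' t',
     tdom t m, tdom t' = tdom t &
     forall W, open W -> W `<=` tdom t -> forall s,
       smooth_mx_on W (fun m => tmap t (s m)) <->
       smooth_mx_on W (fun m => tmap t' (f m (s m)))]) ->
  forall W, open W -> forall s,
    smooth_section_on T W s <-> smooth_section_on T' W (fun m => f m (s m)).
Proof.
move=> h W oW s; split=> sW; apply: section_on_local => m Wm;
  have [t [t' [[ot st] [ot' st'] tm tt' tf]]] := h m;
  (have oI : open (W `&` tdom t) by exact: openI);
  (have sI : W `&` tdom t `<=` tdom t by move=> x []);
  exists (W `&` tdom t) => //.
- apply/st' => //; first by rewrite tt'.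
  by apply/tf => //; apply/st => //; apply: section_on_sub sW => x [].
- apply/st => //; apply/tf => //; apply/st' => //; first by rewrite tt'.
  by apply: section_on_sub sW => x [].
Qed.

End Trivializations.

(** * Model bundles and isomorphisms *)

Section Model.
Context {R : realType} {d : nat} {M : manifold R d}.

(** The linear part of [t]. Since [is_atriv] only asserts that it exists, it is computed as a
    difference at an auxiliary section [b], on which it does not depend over [tdom t]. *)
Definition lin_triv (F : M -> preaffine R) (t : triv F) (b : forall m, F m) :
    triv (fun m => dirv (F m)) :=
  Triv (tdom t) (fun m u => tmap t (act (b m) u) - tmap t (b m)).

Lemma lin_trivE (F : M -> preaffine R) (t : triv F) b m :
  is_atriv t -> tdom t m -> forall a u,
  tmap t (act a u) = tmap t a + tmap (lin_triv t b) (u : dirv (F m)).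
Proof.
move=> [_ vt] /vt[_ [L _ tL]] a u /=.
by rewrite !tL [tmap t (b m) + _]addrC addrK.
Qed.

Lemma lin_triv_vector (F : M -> preaffine R) (t : triv F) b :
  (forall m, is_affine (F m)) -> is_atriv t -> is_vtriv (lin_triv t b).
Proof.
move=> aF [ot vt]; split=> // m tm; have [tb [L lL tL]] := vt m tm.
suff -> : @tmap _ _ _ _ (lin_triv t b) m = L.
  by have := linpart_bij (aF m) tb tL.
by apply/funext => u /=; rewrite tL addrC addKr.
Qed.

Lemma lin_triv_model (A : affdata M) (t : triv (afib A)) b :
  is_affine_bundle A -> aatlas t -> @vatlas _ _ _ (model A) (lin_triv t b).
Proof.
move=> [_ triA _ _] tA; exists (@tmap _ _ _ _ t); split.
  by rewrite /lin_triv /=; case: t tA.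
by move=> m tm a u; apply: lin_trivE => //; exact: triA.
Qed.

(** In each trivialization the coordinates of [act a u] are those of [a] plus those of [u]. A smooth
    [a] thus turns questions about the model bundle into questions about [A]. *)
Lemma model_sections (A : affdata M) W a u :
  is_affine_bundle A -> open W -> @asmooth_on _ _ _ A W a ->
  @vsmooth_on _ _ _ (model A) W u <->
  @asmooth_on _ _ _ A W (fun m => act (a m) (u m)).
Proof.
move=> bA oW sa; have [aA triA _ _] := bA; split=> h t tA.
  have [ot _] := triA t tA; have oI : open (W `&` tdom t) by exact: openI.
  apply: smooth_mx_ext (smooth_mxD oI (sa t tA) (h _ (lin_triv_model a bA tA))).
    by [].
  by move=> m [_ tm]; rewrite (lin_trivE a) //; exact: triA.
have [c [cA ct]] := tA.
have [ot _] := triA _ cA; have oI : open (W `&` tdom t) by exact: openI.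
apply: smooth_mx_ext (smooth_mxB oI (h _ cA) (sa _ cA)) => //.
by move=> m [_ tm] /=; rewrite ct // addrC addKr.
Qed.

Lemma lin_triv_smooth (A : affdata M) (t : triv (afib A)) b :
  is_affine_bundle A -> is_atriv t -> smooth_triv (@aatlas _ _ _ A) t ->
  smooth_triv (@vatlas _ _ _ (model A)) (lin_triv t b).
Proof.
move=> bA vt [ot st]; split=> // W oW sub u; have [aA _ _ _] := bA.
have [a ta] := section_affine aA vt (fun=> 0).
have sta : smooth_mx_on W (fun m => tmap t (a m)).
  by apply: smooth_mx_ext (smooth_mx_cst _ 0) => // m /sub /ta->.
have sa : @asmooth_on _ _ _ A W a by apply/st.
apply: (iff_trans (model_sections u bA oW sa)).
apply: (iff_trans (st _ oW sub _)); split=> h.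
  apply: smooth_mx_ext (smooth_mxB oW h sta) => // m /sub tm.
  by rewrite (lin_trivE b vt tm) addrC addKr.
apply: smooth_mx_ext (smooth_mxD oW sta h) => // m /sub tm.
by rewrite (lin_trivE b vt tm).
Qed.

Lemma model_bundle (A : affdata M) : is_affine_bundle A ->
  is_vector_bundle (model A).
Proof.
move=> bA; have [aA triA covA _] := bA.
pose b m : A m := sval (cid (aA m).1).
(* A member of this atlas is linked to a member of the atlas of [A] only through its linear part;
   over its domain it agrees with [lin_triv], from which both properties are transferred. *)
have key t : @vatlas _ _ _ (model A) t -> exists2 t' : triv (afib A),
    @aatlas _ _ _ A t' & tdom t = tdom t' /\
    is_vtriv t /\ smooth_triv (@vatlas _ _ _ (model A)) t.
  move=> tm; have [c [cA ct]] := tm; exists (Triv (tdom t) c) => //; split=> //.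
  have tE m (u : dirv (A m)) : tdom t m ->
      tmap t u = tmap (lin_triv (Triv (tdom t) c) b) u.
    by move=> /ct /(_ (b m) u) /= ->; rewrite addrC addKr.
  have [ov lv] := lin_triv_vector b aA (triA _ cA); split.
    split=> // m tm'; have [h1 h2] := lv m tm'.
    suff -> : @tmap _ _ _ _ t m =
      @tmap _ _ _ _ (lin_triv (Triv (tdom t) c) b) m by [].
    by apply/funext => u; exact: tE.
  have [_ sv] := lin_triv_smooth b bA (triA _ cA) (aatlas_smooth bA cA).
  split=> // W oW sub s; apply: (iff_trans (sv W oW sub s)).
  by split; apply: smooth_mx_ext => // m /sub /tE->.
apply: vector_bundle_of_smooth => [t /key[? _ [_ []]]|t /key[? _ [_ []]]|m] //.
have [t tA tm] := covA m; exists (lin_triv t b) => //; exact: lin_triv_model.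
Qed.

End Model.

(** * Isomorphisms recognized on local sections *)

Section Isomorphisms.
Context {R : realType} {d : nat} {M : manifold R d}.

(** Formulated without trivializations and with an equivalence on sections, so that it is visibly
    stable under inverse and composition. *)
Definition smooth_affine_bij (A B : affdata M) (f : forall m, A m -> B m)
    (fv : forall m, dirv (A m) -> dirv (B m)) : Prop :=
  [/\ forall m, linear (fv m) /\
        forall a u, f m (act a u) = act (f m a) (fv m u),
      forall m, bijective (f m), forall m, bijective (fv m) &
      forall W, open W -> forall s,
        @asmooth_on _ _ _ A W s <-> @asmooth_on _ _ _ B W (fun m => f m (s m))].

Lemma smooth_affine_bij_inv (A B : affdata M) f fv g gv :
  @smooth_affine_bij A B f fv ->
  (forall m, cancel (f m) (g m) /\ cancel (g m) (f m)) ->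
  (forall m, cancel (fv m) (gv m) /\ cancel (gv m) (fv m)) ->
  @smooth_affine_bij B A g gv.
Proof.
move=> [lf fb fvb sf] fg fgv; split=> [m|m|m|W oW s].
- have [fK gK] := fg m; have [fvK gvK] := fgv m; have [lv fa] := lf m.
  split=> [c u v|a u]; first by apply: (bij_inj (fvb m)); rewrite lv !gvK.
  by apply: (bij_inj (fb m)); rewrite fa !gK gvK.
- by have [? ?] := fg m; exists (f m).
- by have [? ?] := fgv m; exists (fv m).
- apply: iff_sym; apply: (iff_trans (sf W oW _)).
  suff -> : (fun m => f m (g m (s m))) = s by [].
  by apply: functional_extensionality_dep => m; have [_ ->] := fg m.
Qed.

Lemma smooth_affine_bij_comp (A B C : affdata M) f fv g gv :
  @smooth_affine_bij A B f fv -> @smooth_affine_bij B C g gv ->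
  @smooth_affine_bij A C (fun m a => g m (f m a)) (fun m u => gv m (fv m u)).
Proof.
move=> [lf fb fvb sf] [lg gb gvb sg]; split=> [m|m|m|W oW s].
- have [lv fa] := lf m; have [lw ga] := lg m; split; first exact: linear_comp.
  by move=> a u; rewrite fa ga.
- exact: (bij_comp (gb m) (fb m)).
- exact: (bij_comp (gvb m) (fvb m)).
- by apply: (iff_trans (sf W oW s)); exact: sg.
Qed.

Lemma smooth_affine_bij_inverse (A B : affdata M) f fv :
  @smooth_affine_bij A B f fv -> exists g gv,
  [/\ @smooth_affine_bij B A g gv,
      forall m, cancel (f m) (g m) /\ cancel (g m) (f m) &
      forall m, cancel (fv m) (gv m) /\ cancel (gv m) (fv m)].
Proof.
move=> sf; have [_ fb fvb _] := sf.
have inv (X Y : M -> Type) (h : forall m, X m -> Y m) :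
    (forall m, bijective (h m)) ->
    exists k : forall m, Y m -> X m,
      forall m, cancel (h m) (k m) /\ cancel (k m) (h m).
  move=> hb; have ex m : exists k, cancel (h m) k /\ cancel k (h m).
    by have [k hk kh] := hb m; exists k.
  by exists (fun m => sval (cid (ex m))) => m; exact: (svalP (cid (ex m))).
have [g fg] := inv _ _ _ fb; have [gv fgv] := inv _ _ _ fvb.
by exists g, gv; split=> //; exact: smooth_affine_bij_inv sf fg fgv.
Qed.

Lemma smooth_bij_morphism (A B : affdata M) f fv :
  is_affine_bundle A -> is_affine_bundle B -> @smooth_affine_bij A B f fv ->
  aff_morphism f fv.
Proof.
move=> bA bB [lf _ _ sf]; split=> // t t' tA t'B.
have [aA triA _ _] := bA; have [_ triB _ _] := bB.
apply: smooth_affineP lf _ => //; [exact: triA|exact: triB|move=> s ss].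
have [ot st] := aatlas_smooth bA tA; have [ot' st'] := aatlas_smooth bB t'B.
have oI : open (tdom t `&` tdom t') by exact: openI.
apply/(st' _ oI (@subIsetr _ _ _)); apply/sf => //.
exact/(st _ oI (@subIsetl _ _ _)).
Qed.

Lemma smooth_bij_iso (A B : affdata M) f fv :
  is_affine_bundle A -> is_affine_bundle B -> @smooth_affine_bij A B f fv ->
  aff_iso f fv.
Proof.
move=> bA bB sf; split; first exact: smooth_bij_morphism.
have [g [gv [sg fg _]]] := smooth_affine_bij_inverse sf.
by exists g, gv; split=> //; exact: smooth_bij_morphism.
Qed.

(** Over a trivializing domain there is a smooth section [a] of [A]. There [u] is smooth iff [a + u]
    is, iff its image [f a + fv u] is, iff [fv u] is. Working locally avoids the need for a global
    smooth section. *)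
Lemma smooth_bij_model (A B : affdata M) f fv :
  is_affine_bundle A -> is_affine_bundle B -> @smooth_affine_bij A B f fv ->
  forall W, open W -> forall u, @vsmooth_on _ _ _ (model A) W u <->
    @vsmooth_on _ _ _ (model B) W (fun m => fv m (u m)).
Proof.
move=> bA bB [lf fb fvb sf].
have loc W t (b : forall m, A m) : open W -> W `<=` tdom t ->
    @aatlas _ _ _ A t -> forall u, @vsmooth_on _ _ _ (model A) W u <->
    @vsmooth_on _ _ _ (model B) W (fun m => fv m (u m)).
  move=> oW sub tA u; have [aA triA _ _] := bA.
  have [a ta] := section_affine aA (triA t tA) (fun=> 0).
  have sa : @asmooth_on _ _ _ A W a.
    have [_ st] := aatlas_smooth bA tA; apply/st => //.
    by apply: smooth_mx_ext (smooth_mx_cst _ 0) => // m /sub /ta->.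
  have sfa := (sf W oW a).1 sa.
  apply: (iff_trans (model_sections u bA oW sa)).
  apply: (iff_trans (sf W oW _)); apply: iff_sym.
  apply: (iff_trans (model_sections _ bB oW sfa)).
  suff -> : (fun m => act (f m (a m)) (fv m (u m))) =
            (fun m => f m (act (a m) (u m))) by [].
  by apply: functional_extensionality_dep => m; have [_ ->] := lf m.
have [aA triA covA _] := bA; pose b m : A m := sval (cid (aA m).1).
move=> W oW u; split=> su; apply: section_on_local => m Wm;
  have [t tA tm] := covA m; have [ot _] := triA t tA;
  (have oI : open (W `&` tdom t) by exact: openI);
  exists (W `&` tdom t) => //;
  apply/(loc _ t b oI (@subIsetr _ _ _) tA);
  exact: section_on_sub (@subIsetl _ _ _) su.
Qed.

(** The distinguished section of [B] is the image of that of [A] under the bijective linear part,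
    from which it inherits smoothness and nonvanishing. *)
Lemma smooth_bij_special (A B : special_affdata M) f fv :
  is_special_affine_bundle A -> is_affine_bundle B ->
  @smooth_affine_bij A B f fv -> (forall m, fv m (sdist A m) = sdist B m) ->
  special_aff_iso f fv.
Proof.
move=> hA bB sf fw; have [bA sA nA] := hA; split=> //.
  have [lf _ fvb _] := sf; split=> // [|m].
    suff -> : @sdist _ _ _ B = (fun m => fv m (sdist A m)).
      exact/(smooth_bij_model bA bB sf openT).
    by apply: functional_extensionality_dep => m; rewrite fw.
  rewrite -fw => fv0; apply: (nA m); apply: (bij_inj (fvb m)).
  by rewrite fv0 linear_prop0 //; have [] := lf m.
exact: smooth_bij_iso.
Qed.

Lemma smooth_bij_sections (A B : affdata M) f fv :
  @smooth_affine_bij A B f fv ->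
  set_bij (asections A) (asections B) (fun a m => f m (a m)).
Proof.
move=> sf; have [_ fb _ sfs] := sf.
have [g [gv [_ fg _]]] := smooth_affine_bij_inverse sf; split.
- by move=> a sa; exact/(sfs setT openT).
- move=> a a' _ _ h; apply: functional_extensionality_dep => m.
  by apply: (bij_inj (fb m)); exact: (f_equal (fun s => s m) h).
- move=> s ss; have sE : s = (fun m => f m (g m (s m))).
    by apply: functional_extensionality_dep => m; have [_ ->] := fg m.
  by exists (fun m => g m (s m)) => //; apply/(sfs setT openT); rewrite -sE.
Qed.

Lemma vec_isoP (E F : vecdata M) (f : forall m, E m -> F m) :
  is_vector_bundle E -> is_vector_bundle F ->
  (forall m, linear (f m)) -> (forall m, bijective (f m)) ->
  (forall W, open W -> forall s,
    @vsmooth_on _ _ _ E W s <-> @vsmooth_on _ _ _ F W (fun m => f m (s m))) ->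
  vec_iso E F f.
Proof.
have mor (X Y : vecdata M) (h : forall m, X m -> Y m) :
  is_vector_bundle X -> is_vector_bundle Y ->
  (forall m, linear (h m)) ->
  (forall W, open W -> forall s, @vsmooth_on _ _ _ X W s ->
     @vsmooth_on _ _ _ Y W (fun m => h m (s m))) -> vec_morphism h.
  move=> bX bY lh sh; split=> // t t' tX t'Y.
  have [triX _ _] := bX; have [triY _ _] := bY.
  apply: smooth_linearP lh _; [exact: triX|exact: triY|move=> s ss].
  have [ot st] := vatlas_smooth bX tX; have [ot' st'] := vatlas_smooth bY t'Y.
  have oI : open (tdom t `&` tdom t') by exact: openI.
  apply/(st' _ oI (@subIsetr _ _ _)); apply: sh => //.
  exact/(st _ oI (@subIsetl _ _ _)).
move=> bE bF lf fb sf; split=> //.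
  by apply: mor => // W oW s; apply: (sf W oW s).1.
have ex m : exists k, cancel (f m) k /\ cancel k (f m).
  by have [k hk kh] := fb m; exists k.
pose g m := sval (cid (ex m)).
have fg m : cancel (f m) (g m) /\ cancel (g m) (f m) by exact: (svalP (cid (ex m))).
exists g; split=> //; apply: mor => // [m c u v|W oW s ss].
  by apply: (bij_inj (fb m)); rewrite lf; have [_ gK] := fg m; rewrite !gK.
apply/sf => //; suff -> : (fun m => f m (g m (s m))) = s by [].
by apply: functional_extensionality_dep => m; have [_ ->] := fg m.
Qed.

End Isomorphisms.

(** * Duals and quotients *)

Section Duals.
Context {R : realType}.

Lemma affun_act (B : preaffine R) (f : affun B) a u :
  f (act a u) = f a + linpart f u.
Proof. by have /asboolP[_ h] := affunP f; exact: h. Qed.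

Lemma linpart_linear (B : preaffine R) (f : affun B) :
  linear (linpart f : dirv B -> R^o).
Proof. by have /asboolP[h _] := affunP f; exact: h. Qed.

Lemma affun_lincomb (B : preaffine R) (f g : affun B) (c : R) (a : B) :
  (c *: f + g) a = c * f a + g a.
Proof. by []. Qed.

Lemma affun_add (B : preaffine R) (f g : affun B) (a : B) :
  (f + g) a = f a + g a.
Proof. by []. Qed.

Lemma affun_ext (B : preaffine R) (f g : affun B) :
  is_affine B -> (forall a, f a = g a) -> f = g.
Proof.
move=> [[a _] _] fg; apply: val_inj.
have e1 : (val f).1 = (val g).1 by apply/funext => b; exact: fg.
have e2 : (val f).2 = (val g).2.
  apply/funext => u; have := fg (act a u).
  by rewrite !affun_act fg => /addrI.
by move: e1 e2; case: (val f) => ? ?; case: (val g) => ? ? /= -> ->.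
Qed.

Lemma linform_linear (V : lmodType R) (f : linform V) :
  linear (f : V -> R^o).
Proof. by have /asboolP := linformP f. Qed.

Lemma affun_of_linear (B : preaffine R) (f : B -> R) (g : dirv B -> R^o) :
  linear g -> (forall a u, f (act a u) = f a + g u) ->
  exists F : affun B, forall a, F a = f a.
Proof.
move=> lg fg.
have P : ((f, g) : (B -> R^o) * (dirv B -> R^o)) \in @is_affun R B.
  by apply/asboolP.
by exists (AffFun P).
Qed.

Lemma vcls_surj (V : lmodType R) (v : V) (q : vquo v) : exists x, q = vcls v x.
Proof. by exists (repr q); rewrite vcls_repr. Qed.

Lemma vcls_lincomb (V : lmodType R) (v : V) c x y :
  c *: vcls v x + vcls v y = vcls v (c *: x + y).
Proof. by rewrite vclsD -vclsZ. Qed.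

Lemma affun_expand (B : preaffine R) k (c : B -> 'rV[R]_k)
    (o : B) (p : 'I_k -> B) (f : affun B) :
  is_affine B -> bijective c -> (exists2 L, linear L &
    forall a u, c (act a u) = c a + L u) ->
  c o = 0 -> (forall j, c (p j) = delta_mx 0 j) ->
  forall a, f a = f o + \sum_j c a 0 j * (f (p j) - f o).
Proof.
move=> aB cb [L lL cL] co cp a.
exact: (@affine_expand _ _ aB _ _ _ cb cL R^o f (linpart f) o p lL
  (linpart_linear f) (affun_act f) co cp).
Qed.

End Duals.

Section DualTrivializations.
Context {R : realType} {d : nat} {M : manifold R d}.

Lemma inj_surj_bijective (X Y : Type) (f : X -> Y) :
  injective f -> (forall y, exists x, f x = y) -> bijective f.
Proof.
move=> fi fs; exists (fun y => sval (cid (fs y))) => [x|y].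
  by apply: fi; exact: (svalP (cid (fs (f x)))).
exact: (svalP (cid (fs y))).
Qed.

Definition is_frame (F : M -> Type) (t : triv F) (p : 'I_(trk t) -> forall m, F m) :=
  forall j m, tdom t m -> tmap t (p j m) = delta_mx 0 j.

Section AffDual.
Variables (A : affdata M) (t : triv (afib A)) (o : forall m, A m)
  (p : 'I_(trk t) -> forall m, A m).
Hypotheses (aA : forall m, is_affine (A m)) (vt : is_atriv t)
  (st : smooth_triv (@aatlas _ _ _ A) t)
  (ot : forall m, tdom t m -> tmap t (o m) = 0) (pt : is_frame p).

(** Coordinates of [f] are its value at the origin [o] and its slopes along the axes of [t]. The
    value comes first so that [1_A] is the first basis vector, as the passage to the quotient
    requires. *)
Definition dual_triv : triv (fun m => affun (A m)) :=
  @Triv _ _ _ (fun m => affun (A m)) (tdom t) (1 + trk t) (fun m (f : affun (A m)) =>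
    row_mx (const_mx (f (o m))) (\row_j (f (p j m) - f (o m)))).

Lemma dual_expand m (f : affun (A m)) a : tdom t m ->
  f a = f (o m) + \sum_j tmap t a 0 j * (f (p j m) - f (o m)).
Proof.
move=> tm; have [tb tL] := vt.2 m tm.
by apply: (affun_expand f (aA m) tb tL) => [|j]; [exact: ot|exact: pt].
Qed.

Lemma dual_triv_vector : is_vtriv dual_triv.
Proof.
split=> [|m tm]; first by have [] := vt.
split; last first.
  move=> c f g /=; rewrite scale_row_mx add_row_mx; congr row_mx.
    by apply/rowP => j; rewrite !mxE.
  by apply/rowP => j; rewrite !mxE !affun_lincomb mulrBr opprD addrACA.
apply: inj_surj_bijective => [f g /eq_row_mx[h0 h1]|y].
  apply: affun_ext => // a.
  rewrite (dual_expand f a tm) (dual_expand g a tm).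
  have e0 : f (o m) = g (o m) by move/rowP: h0 => /(_ 0); rewrite !mxE.
  rewrite e0; congr (_ + _); apply: eq_bigr => j _.
  by move/rowP: h1 => /(_ j); rewrite !mxE e0 => ->.
have [_ [L lL tL]] := vt.2 m tm.
have [F FE] : exists F : affun (A m), forall a,
    F a = lsubmx y 0 0 + (tmap t a *m (rsubmx y)^T) 0 0.
  apply: (affun_of_linear (g := fun u => (L u *m (rsubmx y)^T) 0 0)).
    by move=> c u v; rewrite lL mulmxDl -scalemxAl !mxE.
  by move=> a u; rewrite tL mulmxDl [X in _ + X = _]mxE addrA.
exists F; rewrite -[RHS]hsubmxK /=.
have F0 : F (o m) = lsubmx y 0 0 by rewrite FE ot // mul0mx [X in _ + X]mxE addr0.
congr row_mx; apply/rowP => j; rewrite [LHS]mxE F0; first by rewrite ord1.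
by rewrite FE pt // -rowE addrC addKr [LHS]mxE [LHS]mxE.
Qed.

Lemma smooth_of_coords W (a : forall m, A m) : open W -> W `<=` tdom t ->
  smooth_mx_on W (fun m => tmap t (a m)) -> @asmooth_on _ _ _ A W a.
Proof. by move=> oW sub; have [_ h] := st; exact: (h W oW sub a).2. Qed.

(** Evaluating [f] on the sections [o] and [p j], whose coordinates are constant, yields its
    coordinates. Conversely [dual_expand] writes [f a] as a polynomial in the coordinates of [f] and
    of [a]. *)
Lemma dual_triv_mem : @vatlas _ _ _ (aff_dual A) dual_triv.
Proof.
split; first exact: dual_triv_vector.
move=> W oW sub f; split=> [h|].
  have so : smooth_on W (fun m => f m (o m)).
    apply: h => //; apply: smooth_of_coords => //.
    by apply: smooth_mx_ext (smooth_mx_cst _ 0) => // m /sub /ot->.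
  apply/smooth_row_mxP => //; split=> i j.
    by apply: smooth_ext so => // m _; rewrite mxE.
  apply: (@smooth_ext _ _ _ _ (fun m => f m (p j m) - f m (o m))) => //.
    by move=> m _; rewrite mxE.
  apply: smoothB => //; apply: h => //; apply: smooth_of_coords => //.
  by apply: smooth_mx_ext (smooth_mx_cst _ (delta_mx 0 j)) => // m /sub /pt->.
move=> /(smooth_row_mxP _ _ oW)[s0 s1] W' oW' subW a sa.
have sub' : W' `<=` tdom t by move=> m /subW /sub.
have {}sa : smooth_mx_on W' (fun m => tmap t (a m)) 
  by have [_ h] := st; exact: (h W' oW' sub' a).1.
apply: (@smooth_ext _ _ _ _ (fun m =>
  f m (o m) + \sum_j tmap t (a m) 0 j * (f m (p j m) - f m (o m)))) => //.
  by move=> m /sub' tm; rewrite -dual_expand.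
apply: smoothD => //.
  by apply: smooth_ext (smooth_sub subW (s0 0 0)) => // m _; rewrite mxE.
apply: smooth_sum => // j; apply: smoothM => //.
by apply: smooth_ext (smooth_sub subW (s1 0 j)) => // m _; rewrite mxE.
Qed.

End AffDual.

Section LinDual.
Variables (E : vecdata M) (t : triv (vfib E)) (p : 'I_(trk t) -> forall m, E m).
Hypotheses (vt : is_vtriv t) (st : smooth_triv (@vatlas _ _ _ E) t)
  (pt : is_frame p).

Definition lin_dual_triv : triv (fun m => linform (E m)) :=
  @Triv _ _ _ (fun m => linform (E m)) (tdom t) (trk t) (fun m (f : linform (E m)) =>
    \row_j (f (p j m))).

Lemma lin_dual_expand m (f : linform (E m)) a : tdom t m ->
  f a = \sum_j tmap t a 0 j * f (p j m).
Proof.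
move=> tm; have [tb tl] := vt.2 m tm.
apply: (linear_expand (g := f : E m -> R^o) tl (bij_inj tb)) => [j|].
  exact: pt.
exact: linform_linear.
Qed.

Lemma lin_dual_triv_vector : is_vtriv lin_dual_triv.
Proof.
split=> [|m tm]; first by have [] := vt.
split; last by move=> c f g /=; apply/rowP => j; rewrite !mxE.
apply: inj_surj_bijective => [f g h|y].
  apply: val_inj; apply/funext => a /=.
  rewrite (lin_dual_expand f a tm) (lin_dual_expand g a tm).
  apply: eq_bigr => j _.
  by move/rowP: h => /(_ j); rewrite !mxE => ->.
have [_ tl] := vt.2 m tm.
have P : (fun a => (tmap t a *m y^T) 0 0 : R^o) \in @is_linform R (E m).
  by apply/asboolP => c u v; rewrite tl mulmxDl -scalemxAl !mxE.
exists (LinForm P); apply/rowP => j /=.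
by rewrite mxE pt // -rowE !mxE.
Qed.

Lemma lin_dual_triv_mem : @vatlas _ _ _ (lin_dual E) lin_dual_triv.
Proof.
split; first exact: lin_dual_triv_vector.
move=> W oW sub f; split=> [h i j|h W' oW' subW a sa].
  apply: (@smooth_ext _ _ _ _ (fun m => f m (p j m))) => //.
    by move=> m _; rewrite mxE.
  apply: h => //; have [_ h] := st; apply: (h W oW sub _).2.
  by apply: smooth_mx_ext (smooth_mx_cst _ (delta_mx 0 j)) => // m /sub /pt->.
have sub' : W' `<=` tdom t by move=> m /subW /sub.
have {}sa : smooth_mx_on W' (fun m => tmap t (a m)).
  by have [_ h'] := st; exact: (h' W' oW' sub' a).1.
apply: (@smooth_ext _ _ _ _ (fun m =>
  \sum_j tmap t (a m) 0 j * f m (p j m))) => //.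
  by move=> m /sub' tm; rewrite -lin_dual_expand.
apply: smooth_sum => // j; apply: smoothM => //.
by apply: smooth_ext (smooth_sub subW (h 0 j)) => // m _; rewrite mxE.
Qed.

End LinDual.

Section VecQuotient.
Variables (E : vecdata M) (w : forall m, E m) (D : set M) (k : nat)
  (c : forall m, E m -> 'rV[R]_(1 + k)).
Arguments c : clear implicits.
Let t : triv (vfib E) := Triv D c.
Hypotheses (vt : is_vtriv t) (st : smooth_triv (@vatlas _ _ _ E) t)
  (cw : forall m, D m -> c m (w m) = row_mx (const_mx 1) 0).

(** As [w] is the first basis vector, dropping the first coordinate is independent of the
    representative; [vquo_triv_cls] makes this precise. *)
Definition vquo_triv : triv (fun m => vquo (w m)) :=
  @Triv _ _ _ (fun m => vquo (w m)) D k (fun m q => rsubmx (c m (repr q))).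

Lemma vquo_triv_cls m (x : E m) : D m ->
  tmap vquo_triv (vcls (w m) x) = rsubmx (c m x).
Proof.
move=> Dm /=; have /vclsP[r ->] := vcls_repr (vcls (w m) x).
have [_ /(_ m Dm)[_ lc0]] := vt; have lc : linear (c m) := lc0.
rewrite (linear_propD lc) (linear_propZ lc) cw // scale_row_mx scaler0.
by rewrite linearD /= row_mxKr addr0.
Qed.

Lemma vquo_triv_vector : is_vtriv vquo_triv.
Proof.
split=> [|m Dm]; first by have [] := vt.
have [_ /(_ m Dm)[[g gK0 Kg0] lc0]] := vt.
have lc : linear (c m) := lc0; have gK : cancel (c m) g := gK0.
have Kg : cancel g (c m) := Kg0.
split; last first.
  move=> e q q'; have [x ->] := vcls_surj q; have [y ->] := vcls_surj q'.
  by rewrite vcls_lincomb !vquo_triv_cls // lc; apply/rowP => j; rewrite !mxE.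
apply: inj_surj_bijective => [|y].
  move=> q q'; have [x ->] := vcls_surj q; have [y ->] := vcls_surj q'.
  rewrite !vquo_triv_cls // => h.
  apply/vclsP; exists (lsubmx (c m x) 0 0 - lsubmx (c m y) 0 0).
  set r := _ - _.
  have hr : lsubmx (c m x) = lsubmx (c m y) + r *: const_mx 1.
    apply/rowP => j; rewrite ord1 [RHS]mxE [X in _ + X]mxE [const_mx _ _ _]mxE mulr1.
    by rewrite addrC subrK.
  apply: (can_inj gK); rewrite (linear_propD lc) (linear_propZ lc) cw //.
  rewrite -[LHS]hsubmxK h hr -[X in _ = X + _]hsubmxK scale_row_mx scaler0.
  by rewrite add_row_mx addr0.
exists (vcls (w m) (g (row_mx 0 y))).
by rewrite vquo_triv_cls // Kg row_mxKr.
Qed.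

Lemma vquo_triv_mem : @vatlas _ _ _ (vec_quo w) vquo_triv.
Proof.
split; first exact: vquo_triv_vector.
move=> W oW sub q; have [oD hs] := st; split=> h.
  apply: smooth_mx_local => m Wm.
  have [W' [oW' W'm] [subW [e se eq]]] := h m Wm; exists W' => //.
  have sub' : W' `<=` D by move=> x /subW /sub.
  have {}se : smooth_mx_on W' (fun x =>
      row_mx (lsubmx (c x (e x))) (rsubmx (c x (e x)))).
    apply: smooth_mx_ext ((hs _ oW' sub' e).1 se) => // x _.
    by rewrite hsubmxK.
  have [_ sr] := (smooth_row_mxP _ _ oW').1 se.
  apply: smooth_mx_ext sr => // x W'x.
  by rewrite -eq // vquo_triv_cls //; exact: sub'.
move=> m Wm; exists W => //; split=> //.
(* The lift with vanishing first coordinate: its other coordinates are those of [q], so it is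
   smooth. *)
have [|e he] := sections_with_coords (x := fun m => row_mx 0 (tmap vquo_triv (q m))
  : 'rV_(trk t)) (@inhabited_vector _ _ _ E) (t := t).
  by move=> x Dx; have [_ /(_ x Dx)[[g _ Kg] _]] := vt;
    exists (g (row_mx 0 (tmap vquo_triv (q x)))).
exists e.
  apply: (hs _ oW sub e).2; apply: (@smooth_mx_ext _ _ _ _ _ _
    (fun m => row_mx 0 (tmap vquo_triv (q m)))) => //.
    by move=> x /sub Dx; rewrite he.
  by apply/smooth_row_mxP => //; split=> //; exact: smooth_mx_cst.
move=> x /sub Dx; have [_ /(_ x Dx)[qb _]] := vquo_triv_vector.
by apply: (bij_inj qb); rewrite vquo_triv_cls // [c _ _]he // row_mxKr.
Qed.

End VecQuotient.
End DualTrivializations.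

(** * Bundles of sections *)

Section MoreFibres.
Context {R : realType}.

Lemma acls_surj (B : preaffine R) (w : dirv B) (q : aquo w) :
  exists b, q = acls w b.
Proof. by exists (arepr q); rewrite acls_repr. Qed.

Lemma aquo_affine (B : preaffine R) (w : dirv B) :
  is_affine B -> is_affine (aquo w).
Proof.
move=> aB; have [[a _] _] := aB; split; first by exists (acls w a).
move=> q q'; have [x ->] := acls_surj q; have [y ->] := acls_surj q'.
have [u ->] := act_surj aB x y; exists (vcls w u).
split; first by rewrite [RHS](@acls_act _ B w).
move=> v; have [v' ->] := vcls_surj v.
rewrite [X in _ = X -> _](@acls_act _ B w) => /aclsP[r].
rewrite actD => /(act_inj aB) ->.
by apply/vclsP; exists r.
Qed.

Lemma sharp_affine (A : preaffine R) (v : dirv A) :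
  (exists f : sharp v, True) -> is_affine (sharp v).
Proof.
move=> ex; split=> // f g.
have P : val g - val f \in @is_sharp_dir R A v.
  have /eqP hf := valP f; have /eqP hg := valP g; apply/eqP.
  rewrite [LHS](_ : _ = linpart (val g) v - linpart (val f) v) //.
  by rewrite hf hg subrr.
exists (SharpDir P); split.
  by apply: val_inj => /=; rewrite addrC subrK.
move=> h gh; apply: val_inj; apply: (@addrI _ (val f)) => /=.
by rewrite addrC subrK gh.
Qed.

End MoreFibres.

Section AdaptedTrivializations.
Context {R : realType} {d : nat} {M : manifold R d}.

(** * Affine quotients and bundles of affine sections *)

Section AffQuotient.
Variables (B : special_affdata M) (D : set M) (k : nat)
  (c : forall m, B m -> 'rV[R]_(1 + k)).
Arguments c : clear implicits.
Let t : triv (afib B) := Triv D c.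
Let w := @sdist _ _ _ B.
Hypotheses (aB : forall m, is_affine (B m)) (vt : is_atriv t)
  (st : smooth_triv (@aatlas _ _ _ B) t)
  (cw : forall m, D m -> forall a r,
    c m (act a (r *: w m)) = c m a + row_mx (const_mx r) 0).

Definition aquo_triv : triv (fun m => aquo (w m)) :=
  @Triv _ _ _ (fun m => aquo (w m)) D k (fun m q => rsubmx (c m (arepr q))).

Lemma aquo_triv_cls m (x : B m) : D m ->
  tmap aquo_triv (acls (w m) x : aquo (w m)) = rsubmx (c m x).
Proof.
move=> Dm /=; have /aclsP[r ->] := acls_repr (acls (w m) x).
by rewrite cw // linearD /= row_mxKr addr0.
Qed.

Lemma aquo_triv_affine : is_atriv aquo_triv.
Proof.
split=> [|m Dm]; first by have [] := vt.
have [_ /(_ m Dm)[[g gK0 Kg0] [L lL cL0]]] := vt.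
have gK : cancel (c m) g := gK0; have Kg : cancel g (c m) := Kg0.
have cL a u : c m (act a u) = c m a + L u := cL0 a u.
have LE u : rsubmx (L (repr (vcls (w m) u))) = rsubmx (L u).
  have /vclsP[r ->] := vcls_repr (vcls (w m) u).
  have [[a _] _] := aB m; rewrite (linear_propD lL).
  have -> : L (r *: w m) = row_mx (const_mx r) 0.
    by apply: (@addrI _ (c m a)); rewrite -cL cw.
  by rewrite linearD /= row_mxKr addr0.
split.
  apply: inj_surj_bijective => [|y].
    move=> q q'; have [x ->] := acls_surj q; have [y ->] := acls_surj q'.
    rewrite !aquo_triv_cls // => h.
    apply/aclsP; exists (lsubmx (c m x) 0 0 - lsubmx (c m y) 0 0).
    set r := _ - _.
    have hr : lsubmx (c m x) = lsubmx (c m y) + const_mx r.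
      apply/rowP => j; rewrite ord1 [RHS]mxE [const_mx _ _ _]mxE.
      by rewrite addrC subrK.
    apply: (can_inj gK); rewrite cw //.
    rewrite -[LHS]hsubmxK h hr -[X in _ = X + _]hsubmxK.
    by rewrite add_row_mx addr0.
  exists (acls (w m) (g (row_mx 0 y))).
  by rewrite aquo_triv_cls // Kg row_mxKr.
exists (fun u : vquo (w m) => rsubmx (L (repr u))).
  move=> e u v; have [x ->] := vcls_surj u; have [y ->] := vcls_surj v.
  by rewrite vcls_lincomb !LE lL; apply/rowP => j; rewrite !mxE.
move=> q u; have [x ->] := acls_surj q; have [y ->] := vcls_surj u.
have -> : @act _ (aquo (w m)) (acls (w m) x) (vcls (w m) y) =
    acls (w m) (act x y) by exact: acls_act.
by rewrite LE !aquo_triv_cls // cL linearD.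
Qed.

Lemma aquo_triv_mem : @aatlas _ _ _ (aff_quo B) aquo_triv.
Proof.
split; first exact: aquo_triv_affine.
move=> W oW sub q; have [oD hs] := st; split=> h.
  apply: smooth_mx_local => m Wm.
  have [W' [oW' W'm] [subW [e se eq]]] := h m Wm; exists W' => //.
  have sub' : W' `<=` D by move=> x /subW /sub.
  have {}se : smooth_mx_on W' (fun x =>
      row_mx (lsubmx (c x (e x))) (rsubmx (c x (e x)))).
    apply: smooth_mx_ext ((hs _ oW' sub' e).1 se) => // x _.
    by rewrite hsubmxK.
  have [_ sr] := (smooth_row_mxP _ _ oW').1 se.
  apply: smooth_mx_ext sr => // x W'x.
  by rewrite -eq // aquo_triv_cls //; exact: sub'.
move=> m Wm; exists W => //; split=> //.
have [e he] := section_affine aB vt (fun m => row_mx 0 (tmap aquo_triv (q m))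
  : 'rV_(trk t)).
exists e.
  apply: (hs _ oW sub e).2.
  apply: (@smooth_mx_ext _ _ _ _ _ _ (fun m => row_mx 0 (tmap aquo_triv (q m)))) => //.
    by move=> x /sub Dx; rewrite he.
  by apply/smooth_row_mxP => //; split=> //; exact: smooth_mx_cst.
move=> x /sub Dx; have [_ /(_ x Dx)[qb _]] := aquo_triv_affine.
by apply: (bij_inj qb); rewrite aquo_triv_cls // [c _ _]he // row_mxKr.
Qed.

Variables (o : forall m, aff_quo B m) (p : 'I_k -> forall m, aff_quo B m).
Hypotheses (ot : forall m, D m -> tmap aquo_triv (o m) = 0)
  (pt : is_frame (t := aquo_triv) p).

Let dual := @dual_triv _ _ _ (aff_quo B) aquo_triv o p.

Lemma aquo_dual_mem : @vatlas _ _ _ (aff_dual (aff_quo B)) dual.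
Proof.
apply: dual_triv_mem => //.
- by move=> m; apply: aquo_affine.
- exact: aquo_triv_affine.
- exact: (aff_of_smooth aquo_triv_mem).
Qed.

(** Under the splitting given by [c], a section of [B -> B/<w>] is a graph over
    the quotient, hence an affine function; the sign matches the convention
    that the distinguished section of [AS] is [-1]. *)
Definition asec_triv : triv (afib (AS B)) :=
  @Triv _ _ _ (afib (AS B)) D (1 + k) (fun m (s : asec (w m)) =>
    - row_mx (const_mx (lsubmx (c m (val s (o m))) 0 0))
        (\row_j (lsubmx (c m (val s (p j m))) 0 0
                 - lsubmx (c m (val s (o m))) 0 0))).

(** The first coordinate of [s q] is affine in [q], and the others are the coordinates of [q]
    itself, so this function is the graph that determines [s]. *)
Lemma asec_affun m (s : asec (w m)) : D m ->
  exists f : affun (aquo (w m)), forall q, f q = lsubmx (c m (val s q)) 0 0.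
Proof.
move=> Dm; have [_ /(_ m Dm)[_ [L lL cL]]] := vt.
have /asboolP[[L' [lL' sL']] _] := valP s.
apply: (affun_of_linear (g := fun u => lsubmx (L (L' u)) 0 0)).
  by move=> e u v; rewrite lL' lL !mxE.
by move=> q u; rewrite sL' [c _ _]cL !mxE.
Qed.

Lemma asec_trivE m (s : asec (w m)) (f : affun (aquo (w m))) :
  (forall q, f q = lsubmx (c m (val s q)) 0 0) ->
  tmap asec_triv (s : AS B m) = - tmap dual f.
Proof.
move=> fs; congr (- row_mx _ _); apply/rowP => j; first by rewrite [LHS]mxE [RHS]mxE fs.
by rewrite [LHS]mxE [RHS]mxE !fs.
Qed.

(** Translating by [f q *: w] adds [f] to the first coordinate, since [w] is the first basis vector;
    the sign in [asec_triv] turns this into a subtraction. *)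
Lemma asec_triv_act m (s : asec (w m)) (f : affun (aquo (w m))) : D m ->
  tmap asec_triv (act s f : AS B m) = tmap asec_triv (s : AS B m) - tmap dual f.
Proof.
move=> Dm; have [g gs] := asec_affun s Dm; rewrite (asec_trivE gs).
rewrite (asec_trivE (f := g + f)); last first.
  by move=> q; rewrite affun_add gs cw // linearD /= row_mxKl !mxE.
have [_ /(_ m Dm)[_ ld]] := (aquo_dual_mem).1.
by rewrite (linear_propD ld) opprD.
Qed.

Lemma asec_triv_inj m : D m -> injective (@tmap _ _ _ _ asec_triv m).
Proof.
move=> Dm s s'; have [g gs] := asec_affun s Dm; have [g' gs'] := asec_affun s' Dm.
rewrite (asec_trivE gs) (asec_trivE gs') => /oppr_inj h.
have [_ /(_ m Dm)[db _]] := (aquo_dual_mem).1.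
have {}h := bij_inj db h; apply: val_inj; apply/funext => q.
have [_ /(_ m Dm)[cb _]] := vt; apply: (bij_inj cb).
have /asboolP[_ sq] := valP s; have /asboolP[_ sq'] := valP s'.
rewrite -[LHS]hsubmxK -[RHS]hsubmxK; congr row_mx.
  by apply/rowP => j; rewrite ord1 -[LHS]gs -[RHS]gs' h.
by rewrite -[LHS]aquo_triv_cls // -[RHS]aquo_triv_cls // sq sq'.
Qed.

Lemma asec_affine m : D m -> (exists s : asec (w m), True) ->
  is_affine (asec (w m)).
Proof.
move=> Dm ex; split=> // s s'.
have [g gs] := asec_affun s Dm; have [g' gs'] := asec_affun s' Dm.
have [_ /(_ m Dm)[db ld]] := (aquo_dual_mem).1.
(* The difference of two sections is the difference of the functions of which they are graphs. *)
exists (g' - g); split.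
  apply: (asec_triv_inj Dm); rewrite (asec_triv_act s _ Dm).
  rewrite (asec_trivE gs) (asec_trivE gs') (linear_propB ld).
  by rewrite opprB addrA addNr add0r.
move=> f fs; apply: (bij_inj db); apply: oppr_inj.
apply: (@addrI _ (tmap asec_triv (s : AS B m))).
rewrite -(asec_triv_act s f Dm) -fs (asec_trivE gs) (asec_trivE gs').
by rewrite (linear_propB ld) opprB addrA addNr add0r.
Qed.

Hypothesis ex : forall m, exists s : asec (w m), True.

Lemma asec_triv_affine : is_atriv asec_triv.
Proof.
split=> [|m Dm]; first by have [] := vt.
have [_ /(_ m Dm)[[g gK Kg] ld]] := (aquo_dual_mem).1.
split.
  apply: inj_surj_bijective => [|y]; first exact: asec_triv_inj.
  (* Acting subtracts dual coordinates, so [y] is reached from any section [s] by the function whose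
     coordinates are those of [s] minus [y]. *)
  have [s _] := ex m; exists (act s (g (tmap asec_triv (s : AS B m) - y))).
  by rewrite (asec_triv_act s _ Dm) Kg subKr.
exists (fun f => - tmap dual f).
  by move=> e u v; rewrite ld opprD scalerN.
by move=> s f; exact: asec_triv_act.
Qed.

Lemma asec_triv_mem : @aatlas _ _ _ (AS B) asec_triv.
Proof.
split; first exact: asec_triv_affine.
move=> W oW sub s; have [oD hs] := st.
have [_ hq] := aff_of_smooth aquo_triv_mem.
(* All coordinates of [s q] but the first are those of [q], which is smooth already; only the first
   one has to be tested. *)
have coords W' q : open W' -> W' `<=` W ->
    @asmooth_on _ _ _ (aff_quo B) W' q ->
    @asmooth_on _ _ _ B W' (fun m => val (s m) (q m)) <->
    smooth_on W' (fun m => lsubmx (c m (val (s m) (q m))) 0 0).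
  move=> oW' subW sq; have sub' : W' `<=` D by move=> x /subW /sub.
  apply: (iff_trans (hs _ oW' sub' _)); split=> h.
    apply: smooth_ext (h 0 (lshift k 0)) => // m _; by rewrite [RHS]mxE.
  apply: (@smooth_mx_ext _ _ _ _ _ _ (fun m =>
    row_mx (lsubmx (c m (val (s m) (q m)))) (tmap aquo_triv (q m)))) => //.
    move=> m /sub' Dm; have /asboolP[_ sE] := valP (s m).
    by rewrite -[in tmap _ _](sE (q m)) aquo_triv_cls // hsubmxK.
  apply/smooth_row_mxP => //; split; last exact: (hq _ oW' sub' q).1.
  by move=> i j; rewrite !ord1.
have fE m (f : affun (aquo (w m))) : D m ->
    (forall q, f q = lsubmx (c m (val (s m) q)) 0 0) -> forall q,
    f q = f (o m) + \sum_j tmap aquo_triv q 0 j * (f (p j m) - f (o m)).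
  move=> Dm _ q; apply: (@dual_expand _ _ _ (aff_quo B) aquo_triv o p) => //.
    by move=> x; exact: aquo_affine.
  exact: aquo_triv_affine.
have so : @asmooth_on _ _ _ (aff_quo B) W o.
  apply/(hq _ oW sub); apply: smooth_mx_ext (smooth_mx_cst _ 0) => //.
  by move=> m /sub /ot->.
have sp j : @asmooth_on _ _ _ (aff_quo B) W (p j).
  apply/(hq _ oW sub); apply: smooth_mx_ext (smooth_mx_cst _ (delta_mx 0 j)) => //.
  by move=> m /sub /pt->.
split=> h.
  apply/smooth_mxNP => //.
  have ho := (coords W o oW (@subset_refl _ _) so).1 (h W oW (@subset_refl _ _) o so).
  have hp j := (coords W (p j) oW (@subset_refl _ _) (sp j)).1
    (h W oW (@subset_refl _ _) (p j) (sp j)).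
  apply/smooth_row_mxP => //; split=> i j.
    by apply: smooth_ext ho => // m _; rewrite [RHS]mxE.
  by apply: smooth_ext (smoothB oW (hp j) ho) => // m _; rewrite [RHS]mxE.
move=> W' oW' subW q sq; apply/(coords W' q) => //.
have sub' : W' `<=` D by move=> x /subW /sub.
have [s0 s1] := (smooth_row_mxP _ _ oW).1 ((smooth_mxNP _ oW).1 h).
apply: (@smooth_ext _ _ _ _ (fun m => lsubmx (c m (val (s m) (o m))) 0 0 +
  \sum_j tmap aquo_triv (q m) 0 j *
    (lsubmx (c m (val (s m) (p j m))) 0 0 - lsubmx (c m (val (s m) (o m))) 0 0))) => //.
  move=> m /sub' Dm; have [f fs] := asec_affun (s m) Dm.
  apply: esym; apply: etrans (esym (fs _)) _.
  apply: etrans (fE m f Dm fs (q m)) _; congr (_ + _); first exact: fs.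
  by apply: eq_bigr => j _; congr (_ * (_ - _)); exact: fs.
apply: smoothD => //.
  by apply: smooth_ext (smooth_sub subW (s0 0 0)) => // m _; rewrite [LHS]mxE.
apply: smooth_sum => // j; apply: smoothM => //.
  exact: ((hq _ oW' sub' q).1 sq 0 j).
by apply: smooth_ext (smooth_sub subW (s1 0 j)) => // m _; rewrite [LHS]mxE.
Qed.

End AffQuotient.
End AdaptedTrivializations.

(** * Bundles of linear sections *)

Section LinearSectionBundle.
Context {R : realType} {d : nat} {M : manifold R d}.
Variables (E : vecdata M) (w : forall m, E m) (D : set M) (k : nat)
  (c : forall m, E m -> 'rV[R]_(1 + k)).
Arguments c : clear implicits.
Let t : triv (vfib E) := Triv D c.
Hypotheses (vt : is_vtriv t) (st : smooth_triv (@vatlas _ _ _ E) t)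
  (cw : forall m, D m -> c m (w m) = row_mx (const_mx 1) 0).

(** With [E] the bundle [dag A] and [w] its section [dag1 A], this is the affine bundle underlying
    [LS A]. *)
Definition lsec_bundle : affdata M :=
  aff_of (F := fun m => lsec (w m)) (fun W s =>
    forall W', open W' -> W' `<=` W -> forall q,
      @vsmooth_on _ _ _ (vec_quo w) W' q ->
      @vsmooth_on _ _ _ E W' (fun m => val (s m) (q m))).

Let qt := @vquo_triv _ _ _ E w D k c.

Variable (p : 'I_k -> forall m, vec_quo w m).
Hypothesis (pt : is_frame (t := qt) p).

Let dual := @lin_dual_triv _ _ _ (vec_quo w) qt p.

Lemma vquo_dual_mem : @vatlas _ _ _ (lin_dual (vec_quo w)) dual.
Proof.
apply: lin_dual_triv_mem => //; first exact: vquo_triv_vector.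
exact: (vec_of_smooth (vquo_triv_mem vt st cw)).
Qed.

(** The linear analogue of [asec_triv], with the same sign: the graph is a linear function on the
    quotient, so its values on a frame suffice and the rank is [k]. *)
Definition lsec_triv : triv (afib lsec_bundle) :=
  @Triv _ _ _ (afib lsec_bundle) D k (fun m (s : lsec (w m)) =>
    - \row_j lsubmx (c m (val s (p j m))) 0 0).

Lemma lsec_linform m (s : lsec (w m)) : D m ->
  exists f : linform (vquo (w m)), forall q, f q = lsubmx (c m (val s q)) 0 0.
Proof.
move=> Dm; have [_ /(_ m Dm)[_ lc0]] := vt; have lc : linear (c m) := lc0.
have /asboolP[ls _] := valP s.
have P : (fun q => lsubmx (c m (val s q)) 0 0 : R^o) \in @is_linform R (vquo (w m)).
  by apply/asboolP => e u v; rewrite ls lc !mxE.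
by exists (LinForm P).
Qed.

Lemma lsec_trivE m (s : lsec (w m)) (f : linform (vquo (w m))) :
  (forall q, f q = lsubmx (c m (val s q)) 0 0) ->
  tmap lsec_triv (s : lsec_bundle m) = - tmap dual f.
Proof.
by move=> fs; congr (- _); apply/rowP => j; rewrite [LHS]mxE [RHS]mxE fs.
Qed.

Lemma lsec_triv_act m (s : lsec (w m)) (f : linform (vquo (w m))) : D m ->
  tmap lsec_triv (act s f : lsec_bundle m) =
  tmap lsec_triv (s : lsec_bundle m) - tmap dual f.
Proof.
move=> Dm; have [g gs] := lsec_linform s Dm; rewrite (lsec_trivE gs).
have [_ /(_ m Dm)[_ lc0]] := vt; have lc : linear (c m) := lc0.
rewrite (lsec_trivE (f := g + f)); last first.
  move=> q; rewrite [LHS](_ : _ = g q + f q) // gs (linear_propD lc).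
  rewrite (linear_propZ lc) cw // linearD /= scale_row_mx row_mxKl.
  by rewrite [RHS]mxE; congr (_ + _); rewrite !mxE mulr1.
have [_ /(_ m Dm)[_ ld]] := (vquo_dual_mem).1.
by rewrite (linear_propD ld) opprD.
Qed.

Lemma lsec_triv_inj m : D m -> injective (@tmap _ _ _ _ lsec_triv m).
Proof.
move=> Dm s s'; have [g gs] := lsec_linform s Dm; have [g' gs'] := lsec_linform s' Dm.
rewrite (lsec_trivE gs) (lsec_trivE gs') => /oppr_inj h.
have [_ /(_ m Dm)[db _]] := (vquo_dual_mem).1.
have {}h := bij_inj db h; apply: val_inj; apply/funext => q.
have [_ /(_ m Dm)[cb _]] := vt; apply: (bij_inj cb).
have /asboolP[_ sq] := valP s; have /asboolP[_ sq'] := valP s'.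
rewrite -[LHS]hsubmxK -[RHS]hsubmxK; congr row_mx.
  by apply/rowP => j; rewrite ord1 -[LHS]gs -[RHS]gs' h.
rewrite -[LHS](vquo_triv_cls vt cw) // -[RHS](vquo_triv_cls vt cw) //.
by rewrite sq sq'.
Qed.

Lemma lsec_affine m : D m -> (exists s : lsec (w m), True) ->
  is_affine (lsec (w m)).
Proof.
move=> Dm ex; split=> // s s'.
have [g gs] := lsec_linform s Dm; have [g' gs'] := lsec_linform s' Dm.
have [_ /(_ m Dm)[db ld]] := (vquo_dual_mem).1.
exists (g' - g); split.
  apply: (lsec_triv_inj Dm); rewrite (lsec_triv_act s _ Dm).
  rewrite (lsec_trivE gs) (lsec_trivE gs') (linear_propB ld).
  by rewrite opprB addrA addNr add0r.
move=> f fs; apply: (bij_inj db); apply: oppr_inj.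
apply: (@addrI _ (tmap lsec_triv (s : lsec_bundle m))).
rewrite -(lsec_triv_act s f Dm) -fs (lsec_trivE gs) (lsec_trivE gs').
by rewrite (linear_propB ld) opprB addrA addNr add0r.
Qed.

Hypothesis ex : forall m, exists s : lsec (w m), True.

Lemma lsec_triv_affine : is_atriv lsec_triv.
Proof.
split=> [|m Dm]; first by have [] := vt.
have [_ /(_ m Dm)[[g gK Kg] ld]] := (vquo_dual_mem).1.
split.
  apply: inj_surj_bijective => [|y]; first exact: lsec_triv_inj.
  have [s _] := ex m; exists (act s (g (tmap lsec_triv (s : lsec_bundle m) - y))).
  by rewrite (lsec_triv_act s _ Dm) Kg subKr.
exists (fun f => - tmap dual f).
  by move=> e u v; rewrite ld opprD scalerN.
by move=> s f; exact: lsec_triv_act.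
Qed.

Lemma lsec_triv_mem : @aatlas _ _ _ lsec_bundle lsec_triv.
Proof.
split; first exact: lsec_triv_affine.
move=> W oW sub s; have [oD hs] := st.
have [_ hq] := vec_of_smooth (vquo_triv_mem vt st cw).
have coords W' q : open W' -> W' `<=` W ->
    @vsmooth_on _ _ _ (vec_quo w) W' q ->
    @vsmooth_on _ _ _ E W' (fun m => val (s m) (q m)) <->
    smooth_on W' (fun m => lsubmx (c m (val (s m) (q m))) 0 0).
  move=> oW' subW sq; have sub' : W' `<=` D by move=> x /subW /sub.
  apply: (iff_trans (hs _ oW' sub' _)); split=> h.
    apply: smooth_ext (h 0 (lshift k 0)) => // m _; by rewrite [RHS]mxE.
  apply: (@smooth_mx_ext _ _ _ _ _ _ (fun m =>
    row_mx (lsubmx (c m (val (s m) (q m)))) (tmap qt (q m)))) => //.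
    move=> m /sub' Dm; have /asboolP[_ sE] := valP (s m).
    by rewrite -[in tmap _ _](sE (q m)) (vquo_triv_cls vt cw) // hsubmxK.
  apply/smooth_row_mxP => //; split; last exact: (hq _ oW' sub' q).1.
  by move=> i j; rewrite !ord1.
have sp j : @vsmooth_on _ _ _ (vec_quo w) W (p j).
  apply/(hq _ oW sub); apply: smooth_mx_ext (smooth_mx_cst _ (delta_mx 0 j)) => //.
  by move=> m /sub /pt->.
split=> h.
  apply/smooth_mxNP => // i j.
  have hp := (coords W (p j) oW (@subset_refl _ _) (sp j)).1
    (h W oW (@subset_refl _ _) (p j) (sp j)).
  by apply: smooth_ext hp => // m _; rewrite [RHS]mxE.
move=> W' oW' subW q sq; apply/(coords W' q) => //.
have sub' : W' `<=` D by move=> x /subW /sub.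
have sN := (smooth_mxNP _ oW).1 h.
apply: (@smooth_ext _ _ _ _ (fun m => \sum_j tmap qt (q m) 0 j *
  lsubmx (c m (val (s m) (p j m))) 0 0)) => //.
  move=> m /sub' Dm; have [f fs] := lsec_linform (s m) Dm.
  apply: esym; apply: etrans (esym (fs _)) _.
  apply: etrans (@lin_dual_expand _ _ _ (vec_quo w) qt p
    (vquo_triv_vector vt cw) pt m f (q m) Dm) _.
  by apply: eq_bigr => j _; congr (_ * _); exact: fs.
apply: smooth_sum => // j; apply: smoothM => //.
  exact: ((hq _ oW' sub' q).1 sq 0 j).
by apply: smooth_ext (smooth_sub subW (sN 0 j)) => // m _; rewrite [LHS]mxE.
Qed.

End LinearSectionBundle.

(** * Trivializations of [A^#] *)

Section SharpBundle.
Context {R : realType} {d : nat} {M : manifold R d}.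
Variables (A : special_affdata M) (D : set M) (k : nat)
  (c : forall m, A m -> 'rV[R]_(1 + k)).
Arguments c : clear implicits.
Let t : triv (afib A) := Triv D c.
Let v := @sdist _ _ _ A.
Hypotheses (aA : forall m, is_affine (A m)) (vt : is_atriv t)
  (st : smooth_triv (@aatlas _ _ _ A) t)
  (cv : forall m, D m -> forall a r,
    c m (act a (r *: v m)) = c m a + row_mx (const_mx r) 0).
Variables (o : forall m, A m) (p : 'I_(1 + k) -> forall m, A m).
Hypotheses (ot : forall m, D m -> c m (o m) = 0)
  (pt : is_frame (t := t) p).

Let dual := @dual_triv _ _ _ A t o p.

Let mem : @vatlas _ _ _ (dag A) dual.
Proof. exact: dual_triv_mem. Qed.

(** The coordinates of [dual_triv] without the slope along [v], which is [1] on [A^#]. *)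
Definition sharp_triv : triv (afib (sharp_bundle A)) :=
  @Triv _ _ _ (afib (sharp_bundle A)) D (1 + k) (fun m (f : sharp (v m)) =>
    row_mx (const_mx (val f (o m)))
      (\row_j (val f (p (rshift 1 j) m) - val f (o m)))).

Lemma dual_adapted m (f : affun (A m)) : D m ->
  tmap dual f = row_mx (const_mx (f (o m))) (row_mx (const_mx (linpart f (v m)))
      (\row_j (f (p (rshift 1 j) m) - f (o m)))).
Proof.
move=> Dm; congr row_mx; apply/rowP => j.
case: (fintype.split_ordP j) => i ->; last first.
  by rewrite row_mxEr [LHS]mxE [RHS]mxE.
rewrite row_mxEl [LHS]mxE [RHS]mxE ord1.
(* Both points have coordinates [(1, 0)]: the first by the choice of the frame, the second because
   [o] is the origin and [v] the first basis vector. *)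
have -> : p (lshift k 0) m = act (o m) (v m).
  have [_ /(_ m Dm)[cb _]] := vt; apply: (bij_inj cb).
  apply: etrans (pt _ Dm) _; apply: esym.
  rewrite -[v m]scale1r [LHS]cv // ot // add0r.
  apply/rowP => i'; case: (fintype.split_ordP i') => l ->.
    by rewrite row_mxEl !mxE !ord1 eqxx.
  by rewrite row_mxEr !mxE.
by rewrite affun_act addrC addKr.
Qed.

Lemma sharp_dual m (f : sharp (v m)) : D m ->
  tmap dual (val f) =
  row_mx (lsubmx (tmap sharp_triv (f : sharp_bundle A m)))
    (row_mx (const_mx 1) (rsubmx (tmap sharp_triv (f : sharp_bundle A m)))).
Proof.
move=> Dm; rewrite dual_adapted // row_mxKl row_mxKr.
by have /eqP -> := valP f.
Qed.

(** Inserting the slope [1] along [v] among the coordinates [y] gives an affine function that lies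
    in [A^#]. In particular the fibres of [A^#] are nonempty. *)
Lemma sharp_triv_surj m : D m -> forall y, exists f : sharp (v m),
  tmap sharp_triv (f : sharp_bundle A m) = y.
Proof.
move=> Dm y; have [_ /(_ m Dm)[[g _ gK] _]] := (mem).1.
pose x := row_mx (lsubmx y) (row_mx (const_mx 1) (rsubmx y)) : 'rV_(1 + (1 + k)).
have gx : tmap dual (g x) = x by exact: gK.
have := gx; rewrite dual_adapted // => /eq_row_mx[e1 /eq_row_mx[e2 e3]].
have P : linpart (g x) (v m) == 1.
  by move/rowP: e2 => /(_ 0); rewrite !mxE => ->.
exists (exist _ (g x) P).
by rewrite -[RHS]hsubmxK; congr row_mx.
Qed.

Lemma sharp_triv_affine : is_atriv sharp_triv.
Proof.
split=> [|m Dm]; first by have [] := vt.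
have [_ /(_ m Dm)[db _]] := (mem).1.
split.
  apply: inj_surj_bijective => [f g h|]; last exact: sharp_triv_surj.
  by apply: val_inj; apply: (bij_inj db); rewrite !sharp_dual // h.
exists (fun g : sharp_dir (v m) => row_mx (const_mx (sharp_dir_val g (o m)))
  (\row_j (sharp_dir_val g (p (rshift 1 j) m) - sharp_dir_val g (o m)))).
  move=> e f g; rewrite scale_row_mx add_row_mx; congr row_mx.
    by apply/rowP => j; rewrite !mxE.
  by apply/rowP => j; rewrite !mxE !affun_lincomb mulrBr opprD addrACA.
move=> f g; rewrite add_row_mx; congr row_mx.
  by apply/rowP => j; rewrite !mxE.
by apply/rowP => j; rewrite !mxE !affun_add opprD addrACA.
Qed.

(** Adding a constant changes the value at the origin and none of the slopes. Hence [sharp_triv] is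
    adapted to [1_A], and the constructions on quotients and sections apply to [A^#]. *)
Lemma sharp_triv_adapted m : D m -> forall (f : sharp (v m)) r,
  tmap sharp_triv (act f (r *: sharp1 (v m)) : sharp_bundle A m) =
  tmap sharp_triv (f : sharp_bundle A m) + row_mx (const_mx r) 0.
Proof.
move=> Dm f r; have E a : val (act f (r *: sharp1 (v m))) a = val f a + r.
  by rewrite affun_add; congr (_ + _); exact: mulr1.
rewrite add_row_mx addr0; congr row_mx; apply/rowP => j.
  by rewrite [LHS]mxE E !mxE.
by rewrite [LHS]mxE [RHS]mxE !E opprD addrACA subrr addr0.
Qed.

Lemma sharp_triv_mem : @aatlas _ _ _ (sharp_bundle A) sharp_triv.
Proof.
split; first exact: sharp_triv_affine.
move=> W oW sub f; have [_ hd] := vec_of_smooth mem.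
apply: (iff_trans (hd _ oW sub _)); split=> h.
  have {h} := smooth_mx_ext oW (fun m Wm => sharp_dual (f m) (sub m Wm)) h.
  move=> /(smooth_row_mxP _ _ oW)[h0 /(smooth_row_mxP _ _ oW)[_ h1]].
  apply: (@smooth_mx_ext _ _ _ _ _ _ (fun m => row_mx
    (lsubmx (tmap sharp_triv (f m))) (rsubmx (tmap sharp_triv (f m))))) => //.
    by move=> m _; rewrite hsubmxK.
  exact/smooth_row_mxP.
apply: (smooth_mx_ext oW (fun m Wm => esym (sharp_dual (f m) (sub m Wm)))).
have {h} := smooth_mx_ext oW (fun m _ => esym (hsubmxK (tmap sharp_triv (f m)))) h.
move=> /(smooth_row_mxP _ _ oW)[h0 h1].
apply/smooth_row_mxP => //; split=> //.
by apply/smooth_row_mxP => //; split=> //; exact: smooth_mx_cst.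
Qed.

End SharpBundle.

(** * Adapted trivializations *)

Section Adaptation.
Context {R : realType}.

(** Coordinates in the basis of [v] and the basis vectors other than the [i]-th. *)
Definition adapt k (i : 'I_k.+1) (v x : 'rV[R]_k.+1) : 'rV[R]_(1 + k) :=
  row_mx (const_mx (x 0 i / v 0 i))
    (\row_j (x 0 (lift i j) - x 0 i / v 0 i * v 0 (lift i j))).

Lemma adapt_linear k (i : 'I_k.+1) (v : 'rV[R]_k.+1) : linear (adapt i v).
Proof.
move=> c x y; rewrite scale_row_mx add_row_mx; congr row_mx; apply/rowP => j.
  by rewrite !mxE mulrDl mulrA.
by rewrite !mxE mulrBr mulrDl mulrDl !mulrA opprD addrACA.
Qed.

Lemma adapt_self k (i : 'I_k.+1) (v : 'rV[R]_k.+1) : v 0 i != 0 ->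
  adapt i v v = row_mx (const_mx 1) 0.
Proof.
move=> vi; congr row_mx; apply/rowP => j; rewrite !mxE divff //.
by rewrite mul1r subrr.
Qed.

Lemma adapt_bij k (i : 'I_k.+1) (v : 'rV[R]_k.+1) : v 0 i != 0 -> bijective (adapt i v).
Proof.
move=> vi; apply: inj_surj_bijective => [x x' /eq_row_mx[h0 h1]|y].
  have e0 : x 0 i = x' 0 i.
    move/rowP: h0 => /(_ 0); rewrite !mxE => /(congr1 ( *%R^~ (v 0 i))).
    by rewrite !divfK.
  apply/rowP => l; case: (unliftP i l) => [j ->|->] //.
  by move/rowP: h1 => /(_ j); rewrite !mxE e0 => /addIr.
(* The inverse change of basis: the first coordinate of [y] times [v], plus the remaining
   coordinates of [y] placed at the indices other than [i]. *)
exists (\row_l (if unlift i l is Some j then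
    y 0 (rshift 1 j) + y 0 (lshift k 0) * v 0 l else y 0 (lshift k 0) * v 0 l)).
apply/rowP => l; case: (fintype.split_ordP l) => j ->.
  by rewrite row_mxEl !mxE unlift_none mulfK // ord1.
by rewrite row_mxEr !mxE unlift_none liftK mulfK // addrK.
Qed.

Context {d : nat} {M : manifold R d}.

Lemma adapt_smooth k (i : 'I_k.+1) W (v x : M -> 'rV[R]_k.+1) : open W ->
  (forall m, W m -> v m 0 i != 0) -> smooth_mx_on W v ->
  smooth_mx_on W x <-> smooth_mx_on W (fun m => adapt i (v m) (x m)).
Proof.
move=> oW vi sv; split=> [sx|/(smooth_row_mxP _ _ oW)[h0 h1]].
  have s0 := smoothM oW (sx 0 i) (smoothV oW vi (sv 0 i)).
  apply/smooth_row_mxP => //; split=> i' j.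
    by apply: smooth_ext s0 => // m _; rewrite [RHS]mxE.
  apply: smooth_ext (smoothB oW (sx 0 (lift i j))
    (smoothM oW s0 (sv 0 (lift i j)))) => // m _.
  by rewrite [RHS]mxE.
have s0 := h0 0 0.
move=> i' l; rewrite ord1; case: (unliftP i l) => [j ->|->].
  apply: smooth_ext (smoothD oW (h1 0 j) (smoothM oW s0 (sv 0 (lift i j)))) => //.
  by move=> m _; rewrite !mxE subrK.
apply: smooth_ext (smoothM oW s0 (sv 0 i)) => // m Wm.
by rewrite mxE divfK //; exact: vi.
Qed.

(** Some coordinate [i] of [v0] is nonzero at [m0], hence on an open set around it, where [v0] can
    replace the [i]-th basis vector by a smooth change of coordinates. *)
Lemma adapted_triv (A : special_affdata M) m0 :
  is_special_affine_bundle A ->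
  exists (D : set M) (k : nat) (c : forall m, A m -> 'rV[R]_(1 + k)),
    [/\ D m0, is_atriv (Triv D c : triv (afib A)),
        smooth_triv (@aatlas _ _ _ A) (Triv D c) &
        forall m, D m -> forall (a : A m) r,
          c m (act a (r *: sdist A m)) = c m a + row_mx (const_mx r) 0].
Proof.
move=> [bA sv nv]; have [aA triA covA _] := bA.
pose b m : A m := sval (cid (aA m).1).
have [t tA tm0] := covA m0.
have st := aatlas_smooth bA tA; have vt := triA t tA.
have vlt := lin_triv_vector b aA vt.
have := sv _ (lin_triv_model b bA tA); rewrite setTI /=.
move: (vlt) => [_ lt].
have linE m : tdom t m -> forall (a : A m) (u : dirv (A m)),
    tmap t (act a u) = tmap t a + @tmap _ _ _ _ (lin_triv t b) m u.
  by move=> tm a u; exact: (lin_trivE b vt tm a u).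
case: t => D0 n c0 in tA tm0 st vt vlt lt linE *.
pose v m := tmap (lin_triv (Triv D0 c0) b) (sdist A m) : 'rV_n.
move=> sv0; have {sv0} sv0 : smooth_mx_on D0 v by exact: sv0.
have [i vi] : exists i, v m0 0 i != 0.
  apply: contrapT => h; apply: (nv m0).
  have [lb ll] := lt m0 tm0; apply: (bij_inj lb).
  rewrite (linear_prop0 ll); apply/rowP => i; rewrite [RHS]mxE.
  by apply: contrapT => /eqP vi; apply: h; exists i.
have {}tm0 : D0 m0 := tm0.
have c0v m a r : D0 m -> c0 m (act a (r *: sdist A m)) = c0 m a + r *: v m.
  move=> D0m; have [_ ll] := lt m D0m.
  by rewrite -(linear_propZ ll); exact: (linE m D0m).
clear sv linE lt vlt tA; clearbody v.
(* The index [i] forces the rank to be positive, so it has the form [k.+1]. *)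
case: n c0 v i vi sv0 st vt c0v => [|k] c0 v i vi sv0 st vt c0v.
  by case: i vi.
pose D := D0 `&` [set m | v m 0 i != 0].
have [oD0 hst] := st.
have oD : open D by apply: open_neq0.
exists D, k, (fun m a => adapt i (v m) (c0 m a)); split.
- by split.
- split=> // m [D0m vm]; have [_ /(_ m D0m)[cb [L lL cL]]] := vt; split.
    exact: (bij_comp (adapt_bij vm) cb).
  exists (adapt i (v m) \o L); first exact: (linear_comp lL (@adapt_linear _ i _)).
  have {}cL a u : c0 m (act a u) = c0 m a + L u := cL a u.
  by move=> a u; rewrite /= cL (linear_propD (@adapt_linear _ i _)).
- split=> // W oW sub s.
  have sub0 : W `<=` D0 by move=> m /sub [].
  apply: (iff_trans (hst W oW sub0 s)).
  apply: adapt_smooth => //; first by move=> m /sub [].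
  exact: smooth_mx_sub sv0.
- move=> m [D0m vm] a r.
  rewrite c0v // addrC.
  rewrite (@adapt_linear _ i) adapt_self // addrC; congr (_ + _).
  rewrite scale_row_mx scaler0; congr row_mx.
  by apply/rowP => j; rewrite !mxE mulr1.
Qed.

End Adaptation.

(** * The sections defined by a point *)

Section PointSections.
Context {R : realType} (A : preaffine R) (v : dirv A).

Lemma affun_addc (f : affun A) r (a : A) : (f + r *: affun1 A) a = f a + r.
Proof. by rewrite affun_add; congr (_ + _); exact: mulr1. Qed.

Definition sharp_sec_fun (a : A) (q : aquo (sharp1 v)) : sharp v :=
  act (arepr q : sharp v) (- val (arepr q) a *: sharp1 v).

Lemma sharp_act_val (f : sharp v) r (a : A) :
  val (act f (r *: sharp1 v)) a = val f a + r.
Proof. exact: affun_addc. Qed.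

(** Replacing [f] by [f + r] also adds [r] to its value at [a], and the two contributions cancel. *)
Lemma sharp_sec_cls a (f : sharp v) :
  sharp_sec_fun a (acls (sharp1 v) f) = act f (- val f a *: sharp1 v).
Proof.
rewrite /sharp_sec_fun; have /aclsP[r ->] := acls_repr (acls (sharp1 v) f).
by rewrite sharp_act_val actD -scalerDl opprD addrCA subrr addr0.
Qed.

Lemma sharp_sec_proof a : `[< is_asec (sharp_sec_fun a) >].
Proof.
(* The linear part has the same formula as the section, applied to affine functions with zero slope
   along [v]. *)
pose L (u : vquo (sharp1 v)) : sharp_dir v :=
  repr u - sharp_dir_val (repr u) a *: sharp1 v.
have LE (g : sharp_dir v) :
    L (vcls (sharp1 v) g) = g - sharp_dir_val g a *: sharp1 v.
  rewrite /L; have /vclsP[r ->] := vcls_repr (vcls (sharp1 v) g).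
  have -> : sharp_dir_val (g + r *: sharp1 v) a = sharp_dir_val g a + r.
    exact: affun_addc.
  by rewrite scalerDl opprD addrACA subrr addr0.
apply/asboolP; split; last first.
  move=> q; have [f ->] := acls_surj q; rewrite sharp_sec_cls.
  by apply/aclsP; exists (- val f a).
exists L; split=> [c x y|q u].
  have [f ->] := vcls_surj x; have [g ->] := vcls_surj y.
  rewrite vcls_lincomb !LE.
  have -> : sharp_dir_val (c *: f + g) a =
    c * sharp_dir_val f a + sharp_dir_val g a by [].
  by rewrite scalerBr scalerA scalerDl opprD addrACA.
have [f ->] := acls_surj q; have [g ->] := vcls_surj u.
have -> : @act _ (aquo (sharp1 v)) (acls (sharp1 v) f) (vcls (sharp1 v) g) =
    acls (sharp1 v) (act f g) by exact: (@acls_act _ (sharp v)).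
rewrite !sharp_sec_cls LE !actD; congr act.
have -> : val (act f g) a = val f a + sharp_dir_val g a by [].
by rewrite opprD scalerDl !scaleNr addrCA.
Qed.

Definition sharp_sec (a : A) : asec (sharp1 v) :=
  exist (fun s : aquo (sharp1 v) -> sharp v => `[< is_asec s >] : Prop) _
    (sharp_sec_proof a).

(** Since [phi(a + u)] exceeds [phi(a)] by the linear part of [phi] at [u], that much more is
    subtracted; this is where the sign in the identification of the model bundles comes from. *)
Lemma sharp_sec_act a u :
  sharp_sec (act a u) = act (sharp_sec a) (- iota_sharp v u).
Proof.
apply: val_inj; apply/funext => q; have [f ->] := acls_surj q.
rewrite [LHS]sharp_sec_cls.
have -> : val (act (sharp_sec a) (- iota_sharp v u)) (acls (sharp1 v) f) =
    act (sharp_sec_fun a (acls (sharp1 v) f))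
      (- iota_sharp v u (acls (sharp1 v) f) *: sharp1 v) by [].
rewrite sharp_sec_cls iota_sharpE actD -scalerDl; congr (act _ (_ *: _)).
by rewrite affun_act opprD.
Qed.

Lemma sharp_sec_afun a (f : sharp v) : afun_of_sec (val (sharp_sec a)) f = val f a.
Proof.
have E r : act (sharp_sec_fun a (acls (sharp1 v) f)) (r *: sharp1 v) =
    act f ((r - val f a) *: sharp1 v).
  by rewrite sharp_sec_cls actD -scalerDl addrC.
apply: xget_unique => [|r fr].
  by apply: esym; apply: etrans (E _) _; rewrite subrr scale0r act0.
(* Uniqueness: evaluating at [a] turns the equation into [r = f(a)]. *)
have := congr1 (fun g : sharp v => val g a) (etrans fr (E r)).
by rewrite sharp_act_val addrC subrK.
Qed.

Lemma iota_sharp_linear : is_affine (sharp v) ->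
  linear (fun u : dirv A => - iota_sharp v u : affun (aquo (sharp1 v))).
Proof.
move=> aS c x y; apply: affun_ext; first exact: aquo_affine.
move=> q; have [f ->] := acls_surj q.
have N u b : (- iota_sharp v u) b = - (iota_sharp v u b) by [].
rewrite affun_lincomb !N !iota_sharpE linpart_linear.
by rewrite mulrN opprD.
Qed.

Definition dag_sec_fun (a : A) (q : vquo (affun1 A)) : affun A :=
  repr q - (repr q : affun A) a *: affun1 A.

Lemma dag_sec_cls a (f : affun A) :
  dag_sec_fun a (vcls (affun1 A) f) = f - f a *: affun1 A.
Proof.
rewrite /dag_sec_fun; have /vclsP[r ->] := vcls_repr (vcls (affun1 A) f).
by rewrite affun_addc scalerDl opprD addrACA subrr addr0.
Qed.

Lemma dag_sec_proof a : `[< is_lsec (dag_sec_fun a) >].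
Proof.
apply/asboolP; split=> [c x y|q].
  have [f ->] := vcls_surj x; have [g ->] := vcls_surj y.
  rewrite vcls_lincomb !dag_sec_cls affun_lincomb.
  by rewrite scalerBr scalerA scalerDl opprD addrACA.
have [f ->] := vcls_surj q; rewrite dag_sec_cls.
by apply/vclsP; exists (- f a); rewrite scaleNr.
Qed.

Definition dag_sec (a : A) : lsec (affun1 A) :=
  exist (fun s : vquo (affun1 A) -> affun A => `[< is_lsec s >] : Prop) _
    (dag_sec_proof a).

Lemma dag_sec_act a u :
  dag_sec (act a u) = act (dag_sec a) (- iota_dag u).
Proof.
apply: val_inj; apply/funext => q; have [f ->] := vcls_surj q.
rewrite [LHS]dag_sec_cls.
have -> : val (act (dag_sec a) (- iota_dag u)) (vcls (affun1 A) f) =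
    dag_sec_fun a (vcls (affun1 A) f)
      + (- iota_dag u (vcls (affun1 A) f)) *: affun1 A by [].
rewrite dag_sec_cls iota_dagE affun_act -addrA; congr (_ + _).
by rewrite scaleNr scalerDl opprD.
Qed.

Lemma dag_sec_vfun a (f : affun A) : vfun_of_sec (val (dag_sec a)) f = f a.
Proof.
apply: xget_unique => /= [|r]; rewrite dag_sec_cls; first by rewrite subrK.
move=> /(congr1 (fun g : affun A => g a)).
rewrite -addrA -scaleNr -scalerDl affun_addc => ->.
by rewrite addNKr.
Qed.

Lemma iota_dag_linear :
  linear (fun u : dirv A => - iota_dag u : linform (vquo (affun1 A))).
Proof.
move=> c x y; apply: val_inj; apply/funext => q; have [f ->] := vcls_surj q.
rewrite [LHS](_ : _ = - iota_dag (c *: x + y) (vcls (affun1 A) f)) //.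
rewrite [RHS](_ : _ = c * - iota_dag x (vcls (affun1 A) f)
  - iota_dag y (vcls (affun1 A) f)) //.
by rewrite !iota_dagE linpart_linear mulrN opprD.
Qed.

End PointSections.

(** * Transfer from [A] to a bundle of sections *)

Section DerivedBundles.
Context {R : realType} {d : nat} {M : manifold R d}.

Lemma affine_bij_linpart (A B : preaffine R) (f : A -> B) fv :
  is_affine A -> is_affine B -> bijective f ->
  (forall a u, f (act a u) = act (f a) (fv u)) -> bijective fv.
Proof.
move=> aA aB fb fa; have [[a _] _] := aA; apply: inj_surj_bijective => [u u' h|w].
  by apply: (act_inj aA (a := a)); apply: (bij_inj fb); rewrite !fa h.
have [g gK Kg] := fb; have [u hu] := act_surj aA a (g (act (f a) w)).
by exists u; apply: (act_inj aB (a := f a)); rewrite -fa -hu Kg.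
Qed.

(** The part common to [AS] and [LS]. The charts make [f] the identity in coordinates; as the action
    subtracts [e], they make [fv] minus the identity. Directions are compared with the dual bundle
    [vec_of S'] itself, since this is the vector bundle with which [model A] is to be identified. *)
Lemma derived_bundle (A : affdata M) (F : M -> preaffine R)
    (S : set M -> set (forall m, F m)) (S' : set M -> set (forall m, dirv (F m)))
    (f : forall m, A m -> F m) (fv : forall m, dirv (A m) -> dirv (F m)) :
  is_affine_bundle A -> (forall m, is_affine (F m)) ->
  (forall m, linear (fv m) /\
     forall a u, f m (act a u) = act (f m a) (fv m u)) ->
  (forall m0, exists (D : set M) (k : nat) (c : forall m, A m -> 'rV[R]_k)
     (c' : forall m, F m -> 'rV[R]_k) (e : forall m, dirv (F m) -> 'rV[R]_k),
     [/\ D m0, is_atriv (Triv D c : triv (afib A)),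
         smooth_triv (@aatlas _ _ _ A) (Triv D c),
         @aatlas _ _ _ (aff_of S) (Triv D c') &
         @vatlas _ _ _ (@vec_of _ _ _ (fun m => dirv (F m)) S') (Triv D e)] /\
     forall m, D m -> (forall a, c' m (f m a) = c m a) /\
       forall s g, c' m (act s g) = c' m s - e m g) ->
  [/\ is_affine_bundle (aff_of S),
      is_vector_bundle (@vec_of _ _ _ (fun m => dirv (F m)) S'),
      @smooth_affine_bij _ _ _ A (aff_of S) f fv &
      forall W, open W -> forall u, @vsmooth_on _ _ _ (model A) W u <->
        @vsmooth_on _ _ _ (@vec_of _ _ _ (fun m => dirv (F m)) S') W
          (fun m => fv m (u m))].
Proof.
move=> bA aF lf loc; have [aA _ _ _] := bA.
have bS : is_affine_bundle (aff_of S).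
  apply: aff_of_bundle => // m.
  have [D [k [c [c' [e [[Dm _ _ h _] _]]]]]] := loc m.
  by exists (Triv D c').
have bS' : is_vector_bundle (@vec_of _ _ _ (fun m => dirv (F m)) S').
  apply: vec_of_bundle => m.
  have [D [k [c [c' [e [[Dm _ _ _ h] _]]]]]] := loc m.
  by exists (Triv D e).
have fb m : bijective (f m).
  have [D [k [c [c' [e [[Dm vt st h _] hf]]]]]] := loc m.
  have [[_ /(_ m Dm)[c'b _]] _] := h; have [_ /(_ m Dm)[cb _]] := vt.
  have [fc _] := hf m Dm; apply: inj_surj_bijective => [a b ab|s].
    by apply: (bij_inj cb); rewrite -[LHS]fc -[RHS]fc ab.
  have [g _ Kg] := cb; exists (g (c' m s)); apply: (bij_inj c'b).
  by rewrite [LHS]fc; exact: Kg.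
have fvb m : bijective (fv m).
  by have [_ fa] := lf m; exact: (affine_bij_linpart (aA m) (aF m) (fb m) fa).
split=> //.
  split=> //; apply: section_transport => m0.
  have [D [k [c [c' [e [[Dm vt st h _] hf]]]]]] := loc m0.
  exists (Triv D c), (Triv D c'); split=> //; first exact: aff_of_smooth.
  move=> W oW sub s; split; apply: smooth_mx_ext => // m /sub Dm' /=;
  by have [-> _] := hf m Dm'.
pose b m : A m := sval (cid (aA m).1).
apply: section_transport => m0.
have [D [k [c [c' [e [[Dm vt st _ h] hf]]]]]] := loc m0.
exists (lin_triv (Triv D c : triv (afib A)) b), (Triv D e); split=> //.
- exact: lin_triv_smooth.
- exact: vec_of_smooth.
have E m u : D m -> tmap (lin_triv (Triv D c : triv (afib A)) b) u =
    - e m (fv m u).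
  move=> Dm'; have [fc fe] := hf m Dm'; have [_ fa] := lf m.
  by rewrite /= -!fc fa fe addrC addKr.
move=> W oW sub s; apply: iff_sym.
apply: (iff_trans (iff_sym (smooth_mxNP _ oW))).
by split; apply: smooth_mx_ext => // m /sub Dm'; rewrite E.
Qed.

End DerivedBundles.

(** * Coordinates of the sections attached to points *)

Section Charts.
Context {R : realType} {d : nat} {M : manifold R d}.
Variables (A : special_affdata M).
Hypothesis hA : is_special_affine_bundle A.

Let aA m : is_affine (A m). Proof. by have [[]] := hA. Qed.

Lemma sharp_fibre_affine m : is_affine (sharp (sdist A m)).
Proof.
have [D [k [c [Dm vt st cv]]]] := adapted_triv m hA.
have [b0 ho] := section_affine aA vt (fun=> 0).
have [p hp] := frame_affine aA vt.
have [f _] := sharp_triv_surj aA vt st cv ho hp Dm 0.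
by apply: sharp_affine; exists f.
Qed.

Lemma asec_charts m0 : is_affine (asec (sharp1 (sdist A m0))) /\
  exists (D : set M) (k : nat) (c : forall m, A m -> 'rV[R]_k)
     (c' : forall m, asec (sharp1 (sdist A m)) -> 'rV[R]_k)
     (e : forall m, affun (aquo (sharp1 (sdist A m))) -> 'rV[R]_k),
  [/\ D m0, is_atriv (Triv D c : triv (afib A)),
      smooth_triv (@aatlas _ _ _ A) (Triv D c),
      @aatlas _ _ _ (AS (sharp_bundle A)) (Triv D c') &
      @vatlas _ _ _ (aff_dual (aff_quo (sharp_bundle A))) (Triv D e)] /\
  forall m, D m -> (forall a, c' m (sharp_sec _ a) = c m a) /\
    forall s g, c' m (act s g) = c' m s - e m g.
Proof.
have [D [k [c [Dm vt st cv]]]] := adapted_triv m0 hA.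
have [b0 ho] := section_affine aA vt (fun=> 0).
have [p hp] := frame_affine aA vt.
pose B := sharp_bundle A; pose cS := @tmap _ _ _ _ (@sharp_triv _ _ _ A D k b0 p).
have aB m : is_affine (B m) := sharp_fibre_affine m.
have vS : is_atriv (Triv D cS : triv (afib B)).
  by have := sharp_triv_affine aA vt st cv ho hp.
have mS : @aatlas _ _ _ B (Triv D cS).
  by have := sharp_triv_mem aA vt st cv ho hp.
have sS := aff_of_smooth mS.
have wS m : D m -> forall (f : B m) r,
    cS m (act f (r *: sdist B m)) = cS m f + row_mx (const_mx r) 0.
  by move=> Dm' f r; exact: sharp_triv_adapted.
have aQ m : is_affine (aquo (sharp1 (sdist A m))) 
  by exact: (aquo_affine (sharp1 _) (sharp_fibre_affine m)).
pose tQ := @aquo_triv _ _ _ B D k cS.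
have vQ : is_atriv tQ by exact: aquo_triv_affine.
have [b1 ho'] := section_affine aQ vQ (fun=> 0).
have [p' hp'] := frame_affine aQ vQ.
have ex m : exists s : asec (sdist B m), True.
  by have [[a _] _] := aA m; exists (sharp_sec _ a).
split; first exact: (asec_affine aB vS sS wS ho' hp' Dm (ex m0)).
exists D, (1 + k)%N, c, (@tmap _ _ _ _ (@asec_triv _ _ _ B D k cS b1 p')).
exists (@tmap _ _ _ _ (@dual_triv _ _ _ (aff_quo B) tQ b1 p')); split.
  split=> //; first exact: asec_triv_mem.
  exact: (aquo_dual_mem aB vS sS wS ho' hp').
move=> m Dm'; split; last first.
  by move=> s g; exact: (asec_triv_act aB vS sS wS ho' hp' s g Dm').
move=> a; pose x := c m a.
have key q : lsubmx (cS m (sharp_sec_fun a q)) 0 0 =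
    - (lsubmx x 0 0 + (rsubmx x *m (tmap tQ q)^T) 0 0).
  have [f ->] := acls_surj q; rewrite sharp_sec_cls.
  rewrite (aquo_triv_cls wS f Dm' : tmap tQ _ = _) [cS _ _]wS //.
  have lD (y z : 'rV[R]_(1 + k)) : lsubmx (y + z) = lsubmx y + lsubmx z.
    by rewrite linearD.
  rewrite lD [X in X = _]mxE row_mxKl [const_mx _ _ _]mxE.
  rewrite /cS row_mxKl mxE row_mxKr.
  (* The value of [f] at the origin cancels. The term along [v0] is split off because its slope is
     [1] on [A^#], leaving the first coordinate of [a]; the rest is the pairing of the slopes with
     the other coordinates. *)
  rewrite (dual_expand aA vt ho hp (val f) a Dm') big_split_ord /= big_ord1.
  have := dual_adapted vt cv ho hp (val f) Dm'.
  have /eqP -> := valP f => /eq_row_mx[_ h].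
  have -> : val f (p (lshift k 0) m) - val f (b0 m) = 1.
    have /rowP/(_ (lshift k 0)) := h.
    by rewrite row_mxEl !mxE.
  rewrite mulr1 opprD addrA subrr add0r; congr (- (_ + _)).
    by rewrite [RHS]mxE.
  by rewrite [RHS]mxE; apply: eq_bigr => i _; rewrite !mxE.
(* The origin of the quotient has zero slopes and isolates the first coordinate of [a]; the
   difference with the [j]-th frame point below isolates the [j]-th remaining one. *)
have kO : lsubmx (cS m (sharp_sec_fun a (b1 m))) 0 0 = - lsubmx x 0 0.
  by rewrite key ho' // trmx0 mulmx0 mxE [X in _ + X]mxE addr0.
have kP j : lsubmx (cS m (sharp_sec_fun a (p' j m))) 0 0
    - lsubmx (cS m (sharp_sec_fun a (b1 m))) 0 0 = - rsubmx x 0 j.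
  apply: etrans (congr2 (fun y z : R => y - z) (key (p' j m)) kO) _.
  have -> : (rsubmx x *m (tmap tQ (p' j m))^T) 0 0 = rsubmx x 0 j.
    by rewrite hp' // trmx_delta -colE mxE.
  by rewrite opprK opprD addrAC addNr add0r.
apply: (@etrans _ _ (- row_mx (const_mx (- lsubmx x 0 0)) (\row_j (- rsubmx x 0 j)))).
  congr (- row_mx _ _); apply/rowP => j; rewrite [LHS]mxE [RHS]mxE.
    exact: kO.
  exact: kP.
rewrite opp_row_mx -[RHS]hsubmxK; congr row_mx; apply/rowP => j.
  by rewrite [LHS]mxE [X in - X]mxE opprK ord1.
by rewrite [LHS]mxE [X in - X]mxE opprK.
Qed.

(** Any member of the atlas of [A] serves here: the quotient is by [1_A], which is the first basis
    vector of [dual_triv] over every trivialization. The coordinates of a point of [A] reappear as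
    those of a linear form on the slopes. *)
Lemma lsec_charts m0 : is_affine (lsec (affun1 (A m0))) /\
  exists (D : set M) (k : nat) (c : forall m, A m -> 'rV[R]_k)
     (c' : forall m, lsec (affun1 (A m)) -> 'rV[R]_k)
     (e : forall m, linform (vquo (affun1 (A m))) -> 'rV[R]_k),
  [/\ D m0, is_atriv (Triv D c : triv (afib A)),
      smooth_triv (@aatlas _ _ _ A) (Triv D c),
      @aatlas _ _ _ (LS A) (Triv D c') &
      @vatlas _ _ _ (lin_dual (vec_quo (@dag1 _ _ _ A))) (Triv D e)] /\
  forall m, D m -> (forall a, c' m (dag_sec a) = c m a) /\
    forall s g, c' m (act s g) = c' m s - e m g.
Proof.
have [bA _ _] := hA; have [_ triA covA _] := bA.
have [[D k c] tA Dm] := covA m0.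
have vt := triA _ tA; have st := aatlas_smooth bA tA.
have [b0 ho] := section_affine aA vt (fun=> 0).
have [p hp] := frame_affine aA vt.
pose E := dag A; pose w := @dag1 _ _ _ A.
pose cE := @tmap _ _ _ _ (@dual_triv _ _ _ A (Triv D c) b0 p).
have mE : @vatlas _ _ _ E (Triv D cE).
  by have := dual_triv_mem aA vt st ho hp.
have sE := vec_of_smooth mE.
have vE : is_vtriv (Triv D cE : triv (vfib E)) by have [] := mE.
have wE m : D m -> cE m (w m) = row_mx (const_mx 1) 0.
  by move=> _; congr row_mx; apply/rowP => j; rewrite !mxE subrr.
pose tQ := @vquo_triv _ _ _ E w D k cE.
have vQ : is_vtriv tQ by exact: vquo_triv_vector.
have [p' hp'] := frame_vector vQ.
have ex m : exists s : lsec (w m), True.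
  by have [[a _] _] := aA m; exists (dag_sec a).
split; first exact: (lsec_affine vE sE wE hp' Dm (ex m0)).
exists D, k, c, (@tmap _ _ _ _ (@lsec_triv _ _ _ E w D k cE p')).
exists (@tmap _ _ _ _ (@lin_dual_triv _ _ _ (vec_quo w) tQ p')); split.
  split=> //.
    by have := lsec_triv_mem vE sE wE hp' ex.
  by have := vquo_dual_mem vE sE wE hp'.
move=> m Dm'; split; last first.
  by move=> s g; exact: (lsec_triv_act vE sE wE hp' s g Dm').
move=> a; pose x := c m a.
have key q : lsubmx (cE m (dag_sec_fun a q)) 0 0 =
    - (x *m (tmap tQ q)^T) 0 0.
  have [f ->] := vcls_surj q; rewrite dag_sec_cls.
  rewrite (vquo_triv_cls vE wE f Dm' : tmap tQ _ = _).
  rewrite /cE row_mxKl row_mxKr [LHS]mxE.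
  have -> : (f - f a *: affun1 (A m)) (b0 m) = f (b0 m) - f a.
    by rewrite -scaleNr affun_addc.
  rewrite (dual_expand aA vt ho hp f a Dm') opprD addrA subrr add0r; congr (- _).
  by rewrite [RHS]mxE; apply: eq_bigr => i _; rewrite !mxE.
apply: (@etrans _ _ (- \row_j (- x 0 j))).
  congr (- _); apply/rowP => j; rewrite [LHS]mxE [RHS]mxE.
  apply: etrans (key (p' j m)) _; congr (- _).
  by rewrite hp' // trmx_delta -colE mxE.
by apply/rowP => j; rewrite !mxE opprK.
Qed.

End Charts.

(** * The theorem *)

Theorem theorem13 (R : realType) (d : nat) (M : manifold R d)
    (A : special_affdata M) (hA : is_special_affine_bundle A) :
  exists (sigma : forall m, A m -> AS (sharp_bundle A) m)
         (sigmav : forall m, dirv (A m) -> dirv (AS (sharp_bundle A) m))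
         (theta : forall m, AS (sharp_bundle A) m -> LS A m)
         (thetav : forall m, dirv (AS (sharp_bundle A) m) -> dirv (LS A m))
         (sigmah : forall m, A m -> LS A m)
         (sigmahv : forall m, dirv (A m) -> dirv (LS A m)),
    (* isomorphisms of special affine bundles *)
    [/\ special_aff_iso sigma sigmav,
        special_aff_iso theta thetav,
        special_aff_iso sigmah sigmahv,
        (forall m (a : A m), sigmah m a = theta m (sigma m a)) &
        (forall m (u : dirv (A m)), sigmahv m u = thetav m (sigmav m u))] /\
    (* fibrewise description of the correspondence *)
    (forall m (a : A m) (phi : sharp (sdist A m)),
        afun_of_sec (val (sigma m a)) phi = val phi a) /\
    (forall m (a : A m) (phi : dag A m),
        vfun_of_sec (val (sigmah m a)) phi = phi a) /\
    (* sections *)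
    [/\ set_bij (asections A) (asections (AS (sharp_bundle A)))
          (fun a m => sigma m (a m)),
        set_bij (asections (AS (sharp_bundle A))) (asections (LS A))
          (fun s m => theta m (s m)),
        set_bij (asections A) (asections (LS A))
          (fun a m => sigmah m (a m)),
        (forall a, asections A a -> forall m (phi : dag A m),
           vfun_of_sec (val (sigmah m (a m))) phi = phi (a m)) &
        (forall a, asections A a -> forall m (phi : sharp (sdist A m)),
           afun_of_sec (val (sigma m (a m))) phi = val phi (a m))] /\
    (* model vector bundles *)
    [/\ vec_iso (model A) (aff_dual (aff_quo (sharp_bundle A))) sigmav,
        vec_iso (aff_dual (aff_quo (sharp_bundle A)))
                       (lin_dual (vec_quo (dag1 A))) thetav,
        vec_iso (model A) (lin_dual (vec_quo (dag1 A))) sigmahv,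
        (forall X, vsections (model A) X -> forall m,
           sigmav m (X m) = - iota_sharp (sdist A m) (X m)) &
        (forall X, vsections (model A) X -> forall m,
           sigmahv m (X m) = - iota_dag (X m))].
Proof.
have [bA sv nv] := hA; have [aA _ _ _] := bA.
pose sg m (a : A m) : AS (sharp_bundle A) m := sharp_sec (sdist A m) a.
pose sgv m (u : dirv (A m)) : dirv (AS (sharp_bundle A) m) :=
  - iota_sharp (sdist A m) u.
pose sh m (a : A m) : LS A m := dag_sec a.
pose shv m (u : dirv (A m)) : dirv (LS A m) := - iota_dag u.
have [bAS bVS iAS vAS] : [/\ is_affine_bundle (AS (sharp_bundle A)),
    is_vector_bundle (aff_dual (aff_quo (sharp_bundle A))),
    smooth_affine_bij sg sgv &
    forall W, open W -> forall u, @vsmooth_on _ _ _ (model A) W u <->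
      @vsmooth_on _ _ _ (aff_dual (aff_quo (sharp_bundle A))) W
        (fun m => sgv m (u m))].
  apply: derived_bundle => // m;
    [exact: (asec_charts hA m).1| |exact: (asec_charts hA m).2].
  split; first exact: (iota_sharp_linear (sharp_fibre_affine hA m)).
  by move=> a u; exact: sharp_sec_act.
have [bLS bVL iLS vLS] : [/\ is_affine_bundle (LS A),
    is_vector_bundle (lin_dual (vec_quo (@dag1 _ _ _ A))),
    smooth_affine_bij sh shv &
    forall W, open W -> forall u, @vsmooth_on _ _ _ (model A) W u <->
      @vsmooth_on _ _ _ (lin_dual (vec_quo (@dag1 _ _ _ A))) W
        (fun m => shv m (u m))].
  apply: derived_bundle => // m;
    [exact: (lsec_charts hA m).1| |exact: (lsec_charts hA m).2].
  split; first exact: iota_dag_linear.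
  by move=> a u; exact: dag_sec_act.
(* The isomorphism from [AS] to [LS] will be [sh] after the inverse [g] of [sg], so that the
   triangle commutes by cancellation. *)
have [g [gv [ig fg fgv]]] := smooth_affine_bij_inverse iAS.
have iT := smooth_affine_bij_comp ig iLS.
(* Every element of [A^#] has slope [1] along [v0], so the image of [v0] is the constant [-1]. For
   [LS] the corresponding equality holds by definition. *)
have sgw m : sgv m (sdist A m) = sdist (AS (sharp_bundle A)) m.
  apply: affun_ext; first exact: (aquo_affine (sharp1 _) (sharp_fibre_affine hA m)).
  move=> q; have [f ->] := acls_surj q.
  rewrite [LHS](_ : _ = - iota_sharp (sdist A m) (sdist A m) (acls _ f)) //.
  by rewrite iota_sharpE; have /eqP -> := valP f.
have sA := smooth_bij_special hA bAS iAS sgw.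
have hAS : is_special_affine_bundle (AS (sharp_bundle A)) by have [] := sA.
have gvw m : gv m (sdist (AS (sharp_bundle A)) m) = sdist A m.
  by rewrite -sgw; have [-> _] := fgv m.
exists sg, sgv, (fun m s => sh m (g m s)), (fun m u => shv m (gv m u)), sh, shv.
have [sgl _ sgb _] := iAS; have [shl _ shb _] := iLS; have [thl _ thb _] := iT.
split; first split.
- exact: sA.
- by apply: smooth_bij_special iT _ => // m; rewrite gvw.
- exact: smooth_bij_special.
- by move=> m a; have [-> _] := fg m.
- by move=> m u; have [-> _] := fgv m.
split; first by move=> m a phi; exact: sharp_sec_afun.
split; first by move=> m a phi; exact: dag_sec_vfun.
split; split.
- exact: smooth_bij_sections iAS.
- exact: smooth_bij_sections iT.
- exact: smooth_bij_sections iLS.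
- by move=> a _ m phi; exact: dag_sec_vfun.
- by move=> a _ m phi; exact: sharp_sec_afun.
- by apply: vec_isoP => //; [exact: model_bundle|move=> m; have [] := sgl m].
- apply: vec_isoP => //; first by move=> m; have [] := thl m.
  (* Smoothness in each of the two dual bundles is compared with smoothness in [model A]. *)
  move=> W oW s; have sE : s = (fun m => sgv m (gv m (s m))).
    by apply: functional_extensionality_dep => m; have [_ ->] := fgv m.
  have := iff_trans (iff_sym (vAS W oW (fun m => gv m (s m)))) (vLS W oW _).
  by rewrite -sE.
- by apply: vec_isoP => //; [exact: model_bundle|move=> m; have [] := shl m].
- by [].
- by [].
Qed.
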